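(* Let $\mathbb{H}$ be the graded affine Hecke algebra of type $A_{n-1}$ with parameter function identically $1$, and let $d,m\ge1$ be integers with $dm=n$. Let $X$ be the one $W$-type $\mathbb{H}$-module with $X|_{S_n}\cong\sigma_{d\times m}$, the irreducible $S_n$-representation parameterized by the rectangular partition $(d,d,\dots,d)$ ($m$ parts). Then the central character of $X$ is $\chi_{h/2}$, where $h$ is the middle element of the nilpotent orbit of $\mathfrak{sl}(n,\mathbb{C})$ whose Jordan form is given by the strict partition $$\mathrm{hook}(d\times m)=(d+m-1,\ d+m-3,\ \dots,\ |d-m|+1).$$
   Context: Type $A_{n-1}$: $V=\{x\in\mathbb{R}^n:\sum x_i=0\}$ with the standard inner product, $\Phi=\{e_i-e_j:i\ne j\}$, $\Phi^+=\{e_i-e_j:i<j\}$, $\Pi=\{e_i-e_{i+1}\}$, $W=S_n$, $w_0$ the longest element, $V_{\mathbb{C}}=V\otimes_{\mathbb R}\mathbb{C}$. The graded affine Hecke algebra $\mathbb{H}$ (parameter $1$) is the unital associative $\mathbb{C}$-algebra generated by $\{t_w:w\in S_n\}$ and $\{\omega\in V_{\mathbb{C}}\}$ (linear in $\omega$) with relations $t_wt_{w'}=t_{ww'}$; $\omega\omega'=\omega'\omega$; $\omega t_{s_\alpha}-t_{s_\alpha}s_\alpha(\omega)=(\alpha,\omega)$ for $\alpha\in\Pi$, $\omega\in V_{\mathbb C}$. Its center is $S(V_{\mathbb{C}})^W$ and central characters are parameterized by $W\backslash V_{\mathbb{C}}^*$; $\chi_\nu$ is the character $f\mapsto f(\nu)$.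 $V$ is identified with $V^*$ by the inner product. $*$ is the conjugate-linear anti-involution of $\mathbb{H}$ with $t_w^*=t_{w^{-1}}$ and $\omega^*=-t_{w_0}\,w_0(\omega)\,t_{w_0}$ for $\omega\in V$. An $\mathbb{H}$-module is $*$-hermitian if it has a nondegenerate hermitian form with $\langle hx,y\rangle=\langle x,h^*y\rangle$. A one $W$-type module is a simple $*$-hermitian $\mathbb{H}$-module whose restriction to $\mathbb{C}[W]$ is irreducible. (It is known that for $S_n$ the irreducible representations occurring as such restrictions are exactly those of rectangular shape, and that the one $W$-type module with given restriction is unique.) Convention: the partition $(n)$ parameterizes the trivial representation of $S_n$. The middle element $h$ of a nilpotent orbit is the semisimple element of a Lie triple $\{e,h,f\}$, $[h,e]=2e$, $[h,f]=-2f$, $[e,f]=h$, with $e$ in the orbit and $h\in V$ (real diagonal trace-zero matrices); it is well defined up to $S_n$. For Jordan type $\lambda=(\lambda_1,\lambda_2,\dots)$, the entries of $h$ are the numbers $\lambda_i-1,\lambda_i-3,\dots,1-\lambda_i$, over all $i$. *)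

(* Defs.v *)
From HB Require Import structures.
From mathcomp Require Import all_boot all_order all_fingroup all_algebra.
From mathcomp Require Import generic_quotient complex boolp reals mpoly ring.

Set Implicit Arguments.
Unset Strict Implicit.
Unset Printing Implicit Defensive.

Import GRing.Theory Num.Theory.
Local Open Scope ring_scope.
Local Open Scope quotient_scope.

Definition tracefree (F : fieldType) (n : nat) : {pred 'rV[F]_n} :=
  fun v => \sum_i v 0 i == 0.
Arguments tracefree {F n}.

Fact tracefree_submod (F : fieldType) (n : nat) :
  GRing.submod_closed (@tracefree F n).
Proof.
split=> [|c u v]; rewrite !unfold_in.
  by rewrite big1 // => i _; rewrite mxE.
move=> /eqP hu /eqP hv; apply/eqP.
under eq_bigr do rewrite !mxE.
by rewrite big_split -mulr_sumr /= hu hv mulr0 addr0.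
Qed.

HB.instance Definition _ (F : fieldType) (n : nat) :=
  GRing.isSubmodClosed.Build F 'rV[F]_n (@tracefree F n)
    (@tracefree_submod F n).

(* [Vsp R n] is V and [Vsp R[i] n] is its complexification. *)
Record Vsp (F : fieldType) (n : nat) :=
  MkV { Vval :> 'rV[F]_n; VvalP : Vval \in tracefree }.

HB.instance Definition _ (F : fieldType) (n : nat) :=
  [isSub for @Vval F n].
HB.instance Definition _ (F : fieldType) (n : nat) :=
  [Choice of Vsp F n by <:].
HB.instance Definition _ (F : fieldType) (n : nat) :=
  [SubChoice_isSubLmodule of Vsp F n by <:].

(* On the complexification this is the bilinear extension, by which V_C is
   identified with its dual. *)
Definition dotV (F : fieldType) (n : nat) (u v : Vsp F n) : F :=
  \sum_i Vval u 0 i * Vval v 0 i.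

Fact actV_subproof (F : fieldType) (n : nat) (w : 'S_n) (v : Vsp F n) :
  col_perm w (Vval v) \in tracefree.
Proof.
have /eqP hv := VvalP v; apply/eqP; rewrite -[RHS]hv.
rewrite [RHS](reindex_inj (@perm_inj _ w)) /=.
by apply: eq_bigr => i _; rewrite mxE.
Qed.

(* (w v)_i = v_(w i).  The product of permutations is (s * t) i = t (s i), so
   this is a left action (see actVM): with this product the permutation w has
   to send e_i to e_(w^-1 i). *)
Definition actV (F : fieldType) (n : nat) (w : 'S_n) (v : Vsp F n) : Vsp F n :=
  MkV (actV_subproof w v).

Lemma actVM (F : fieldType) (n : nat) (w w' : 'S_n) (v : Vsp F n) :
  actV (w * w')%g v = actV w (actV w' v).
Proof. by apply: val_inj; rewrite /= col_permM. Qed.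

Lemma actV1 (F : fieldType) (n : nat) (v : Vsp F n) : actV 1%g v = v.
Proof. by apply: val_inj; rewrite /= col_perm1. Qed.

Fact actV_linear (F : fieldType) (n : nat) (w : 'S_n) :
  linear (@actV F n w).
Proof. by move=> c u v; apply/val_inj/rowP=> i; rewrite !mxE. Qed.

Lemma dotV_act (F : fieldType) (n : nat) (w : 'S_n) (u v : Vsp F n) :
  dotV (actV w u) (actV w v) = dotV u v.
Proof.
rewrite /dotV [RHS](reindex_inj (@perm_inj _ w)) /=.
by apply: eq_bigr => i _; rewrite !mxE.
Qed.

Fact rootV_subproof (F : fieldType) (n : nat) (i j : 'I_n) :
  delta_mx 0 i - delta_mx 0 j \in @tracefree F n.
Proof.
apply/eqP; under eq_bigr do rewrite !mxE !eqxx /=.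
have E (k : 'I_n) : \sum_(l < n) (l == k)%:R = 1 :> F.
  by rewrite (bigD1 k) //= eqxx big1 ?addr0 // => l /negPf->.
by rewrite big_split sumrN /= !E subrr.
Qed.

Definition rootV (F : fieldType) (n : nat) (i j : 'I_n) : Vsp F n :=
  MkV (@rootV_subproof F n i j).

Fact sucord_subproof (n : nat) (j : 'I_n.-1) : (j.+1 < n)%N.
Proof. by case: n j => [|n] [j]. Qed.

Definition curord (n : nat) (j : 'I_n.-1) : 'I_n := widen_ord (leq_pred n) j.
Definition sucord (n : nat) (j : 'I_n.-1) : 'I_n := Ordinal (sucord_subproof j).

Definition simple_root (F : fieldType) (n : nat) (j : 'I_n.-1) : Vsp F n :=
  rootV F (curord j) (sucord j).
Definition simple_refl (n : nat) (j : 'I_n.-1) : 'S_n :=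
  tperm (curord j) (sucord j).

Definition longest (n : nat) : 'S_n := perm (@rev_ord_inj n).

Fact complexV_subproof (R : realType) (n : nat) (v : Vsp R n) :
  map_mx (real_complex R) (Vval v) \in tracefree.
Proof.
have /eqP hv := VvalP v; apply/eqP; under eq_bigr do rewrite mxE.
by rewrite -rmorph_sum hv rmorph0.
Qed.

Definition complexV (R : realType) (n : nat) (v : Vsp R n) : Vsp R[i] n :=
  MkV (complexV_subproof v).

Fact conjV_subproof (R : realType) (n : nat) (v : Vsp R[i] n) :
  map_mx Num.conj (Vval v) \in tracefree.
Proof.
have /eqP hv := VvalP v; apply/eqP; under eq_bigr do rewrite mxE.
by rewrite -rmorph_sum hv rmorph0.
Qed.

Definition conjV (R : realType) (n : nat) (v : Vsp R[i] n) : Vsp R[i] n :=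
  MkV (conjV_subproof v).

Inductive hterm (R : realType) (n : nat) : Type :=
| HScal of R[i]
| HT of 'S_n
| HV of Vsp R[i] n
| HAdd of hterm R n & hterm R n
| HMul of hterm R n & hterm R n.
Arguments HScal {R n}.
Arguments HT {R n}.

(* The congruence generated by the axioms of unital associative C-algebras, the
   linearity of HV, and the defining relations (the last four).  The relation
   t_1 = 1 makes w |-> t_w a unital embedding of the group algebra. *)
Inductive heq (R : realType) (n : nat) : hterm R n -> hterm R n -> Prop :=
| heq_refl a : heq a a
| heq_sym a b : heq a b -> heq b a
| heq_trans b a c : heq a b -> heq b c -> heq a c
| heq_add a a' b b' : heq a a' -> heq b b' -> heq (HAdd a b) (HAdd a' b')
| heq_mul a a' b b' : heq a a' -> heq b b' -> heq (HMul a b) (HMul a' b')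
| heq_addA a b c : heq (HAdd a (HAdd b c)) (HAdd (HAdd a b) c)
| heq_addC a b : heq (HAdd a b) (HAdd b a)
| heq_add0 a : heq (HAdd (HScal 0) a) a
| heq_mulA a b c : heq (HMul a (HMul b c)) (HMul (HMul a b) c)
| heq_mul1 a : heq (HMul (HScal 1) a) a
| heq_mul0 a : heq (HMul (HScal 0) a) (HScal 0)
| heq_mulDl a b c : heq (HMul (HAdd a b) c) (HAdd (HMul a c) (HMul b c))
| heq_mulDr a b c : heq (HMul a (HAdd b c)) (HAdd (HMul a b) (HMul a c))
| heq_scalD x y : heq (HAdd (HScal x) (HScal y)) (HScal (x + y))
| heq_scalM x y : heq (HMul (HScal x) (HScal y)) (HScal (x * y))
| heq_scalC x a : heq (HMul (HScal x) a) (HMul a (HScal x))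
| heq_linV x u v :
    heq (HV (x *: u + v)) (HAdd (HMul (HScal x) (HV u)) (HV v))
| heq_T1 : heq (HT 1%g) (HScal 1)
| heq_TM w w' : heq (HMul (HT w) (HT w')) (HT (w * w')%g)
| heq_VC u v : heq (HMul (HV u) (HV v)) (HMul (HV v) (HV u))
| heq_cross j v :
    heq (HMul (HV v) (HT (simple_refl j)))
        (HAdd (HMul (HT (simple_refl j)) (HV (actV (simple_refl j) v)))
              (HScal (dotV (simple_root _ j) v))).

HB.instance Definition _ (R : realType) (n : nat) := gen_eqMixin (hterm R n).
HB.instance Definition _ (R : realType) (n : nat) :=
  gen_choiceMixin (hterm R n).

Definition heqb (R : realType) (n : nat) : rel (hterm R n) :=
  fun a b => `[< heq a b >].

Fact heqb_refl (R : realType) (n : nat) : reflexive (@heqb R n).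
Proof. by move=> a; apply/asboolP; exact: heq_refl. Qed.
Fact heqb_sym (R : realType) (n : nat) : ssrbool.symmetric (@heqb R n).
Proof. by move=> a b; apply/asboolP/asboolP; exact: heq_sym. Qed.
Fact heqb_trans (R : realType) (n : nat) : transitive (@heqb R n).
Proof.
by move=> b a c /asboolP ab /asboolP bc; apply/asboolP; exact: heq_trans ab bc.
Qed.

Canonical heqb_equiv (R : realType) (n : nat) :=
  EquivRel (@heqb R n) (@heqb_refl R n) (@heqb_sym R n) (@heqb_trans R n).

Definition hecke (R : realType) (n : nat) : Type := {eq_quot @heqb R n}.
HB.instance Definition _ (R : realType) (n : nat) := Choice.on (hecke R n).
HB.instance Definition _ (R : realType) (n : nat) := EqQuotient.on (hecke R n).

Definition hcls (R : realType) (n : nat) (a : hterm R n) : hecke R n :=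
  \pi_(hecke R n) a.

Lemma hclsP (R : realType) (n : nat) (a b : hterm R n) :
  hcls a = hcls b <-> heq a b.
Proof.
rewrite /hcls; split=> [/eqP|ab]; first by rewrite piE => /asboolP.
by apply/eqP; rewrite piE; apply/asboolP.
Qed.

Lemma hcls_repr (R : realType) (n : nat) (x : hecke R n) : hcls (repr x) = x.
Proof. exact: reprK. Qed.

Lemma hcls_ind (R : realType) (n : nat) (P : hecke R n -> Prop) :
  (forall a, P (hcls a)) -> forall x, P x.
Proof. by move=> H x; rewrite -(hcls_repr x). Qed.

Definition hscal (R : realType) (n : nat) (c : R[i]) : hecke R n :=
  hcls (HScal c).
Arguments hscal : clear implicits.
Definition hadd (R : realType) (n : nat) (x y : hecke R n) : hecke R n :=
  hcls (HAdd (repr x) (repr y)).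
Definition hmul (R : realType) (n : nat) (x y : hecke R n) : hecke R n :=
  hcls (HMul (repr x) (repr y)).
Definition hopp (R : realType) (n : nat) (x : hecke R n) : hecke R n :=
  hmul (hscal R n (-1)) x.

Lemma hclsD (R : realType) (n : nat) (a b : hterm R n) :
  hadd (hcls a) (hcls b) = hcls (HAdd a b).
Proof. by apply/hclsP/heq_add; apply/hclsP; rewrite hcls_repr. Qed.

Lemma hclsM (R : realType) (n : nat) (a b : hterm R n) :
  hmul (hcls a) (hcls b) = hcls (HMul a b).
Proof. by apply/hclsP/heq_mul; apply/hclsP; rewrite hcls_repr. Qed.

Section HeckeAxioms.
Context (R : realType) (n : nat).
Implicit Types x y z : hecke R n.

Fact haddA : associative (@hadd R n).
Proof.
elim/hcls_ind=> a; elim/hcls_ind=> b; elim/hcls_ind=> c; rewrite !hclsD.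
by apply/hclsP/heq_addA.
Qed.

Fact haddC : commutative (@hadd R n).
Proof.
elim/hcls_ind=> a; elim/hcls_ind=> b; rewrite !hclsD; apply/hclsP/heq_addC.
Qed.

Fact hadd0 : left_id (hscal R n 0) (@hadd R n).
Proof. by elim/hcls_ind=> a; rewrite hclsD; apply/hclsP/heq_add0. Qed.

Fact hmulA : associative (@hmul R n).
Proof.
elim/hcls_ind=> a; elim/hcls_ind=> b; elim/hcls_ind=> c; rewrite !hclsM.
by apply/hclsP/heq_mulA.
Qed.

Fact hmul1 : left_id (hscal R n 1) (@hmul R n).
Proof. by elim/hcls_ind=> a; rewrite hclsM; apply/hclsP/heq_mul1. Qed.

Fact hscalC c x : hmul (hscal R n c) x = hmul x (hscal R n c).
Proof. by elim/hcls_ind: x => a; rewrite !hclsM; apply/hclsP/heq_scalC. Qed.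

Fact hmulr1 : right_id (hscal R n 1) (@hmul R n).
Proof. by move=> x; rewrite -hscalC hmul1. Qed.

Fact hmulDl : left_distributive (@hmul R n) (@hadd R n).
Proof.
elim/hcls_ind=> a; elim/hcls_ind=> b; elim/hcls_ind=> c.
by rewrite !(hclsD, hclsM); apply/hclsP/heq_mulDl.
Qed.

Fact hmulDr : right_distributive (@hmul R n) (@hadd R n).
Proof.
elim/hcls_ind=> a; elim/hcls_ind=> b; elim/hcls_ind=> c.
by rewrite !(hclsD, hclsM); apply/hclsP/heq_mulDr.
Qed.

Fact hscalD c d : hscal R n (c + d) = hadd (hscal R n c) (hscal R n d).
Proof. by apply/esym; rewrite hclsD; apply/hclsP/heq_scalD. Qed.

Fact hscalM c d : hscal R n (c * d) = hmul (hscal R n c) (hscal R n d).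
Proof. by apply/esym; rewrite hclsM; apply/hclsP/heq_scalM. Qed.

Fact haddN : left_inverse (hscal R n 0) (@hopp R n) (@hadd R n).
Proof.
move=> x; rewrite /hopp -{2}(hmul1 x) -hmulDl -hscalD addNr.
by elim/hcls_ind: x => a; rewrite hclsM; apply/hclsP/heq_mul0.
Qed.

(* A one-dimensional representation, showing that the algebra is nonzero. *)
Fixpoint htriv (a : hterm R n) : R[i] :=
  match a with
  | HScal c => c
  | HT _ => 1
  | HV v => - \sum_i Vval v 0 i * i%:R
  | HAdd a b => htriv a + htriv b
  | HMul a b => htriv a * htriv b
  end.

Fact dotV_root (v : Vsp R[i] n) (i j : 'I_n) :
  dotV (rootV _ i j) v = Vval v 0 i - Vval v 0 j.
Proof.
have E (k : 'I_n) : \sum_l (l == k)%:R * Vval v 0 l = Vval v 0 k.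
  rewrite (bigD1 k) //= eqxx mul1r big1 ?addr0 // => l /negPf->.
  by rewrite mul0r.
rewrite /dotV; under eq_bigr do rewrite !mxE !eqxx /= mulrBl.
by rewrite big_split sumrN /= !E.
Qed.

Fact htriv_heq a b : heq a b -> htriv a = htriv b.
Proof.
elim=> {a b} //=.
- by move=> b a c _ -> _ ->.
- by move=> a a' b b' _ -> _ ->.
- by move=> a a' b b' _ -> _ ->.
- by move=> *; rewrite addrA.
- by move=> *; rewrite addrC.
- by move=> *; rewrite add0r.
- by move=> *; rewrite mulrA.
- by move=> *; rewrite mul1r.
- by move=> *; rewrite mul0r.
- by move=> *; rewrite mulrDl.
- by move=> *; rewrite mulrDr.
- by move=> *; rewrite mulrC.
- move=> c u v; rewrite mulrN mulr_sumr -opprD -big_split /=.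
  by congr (- _); apply: eq_bigr => i _; rewrite !mxE mulrDl mulrA.
- by move=> *; rewrite mulr1.
- by move=> *; rewrite mulrC.
move=> j v; rewrite mulr1 mul1r dotV_root /simple_refl.
set p := curord j; set q := sucord j.
have pq : p != q by rewrite -val_eqE /= neq_ltn ltnSn.
rewrite (bigD1 p) //= (bigD1 q) 1?eq_sym //=.
rewrite [in RHS](bigD1 p) //= [in RHS](bigD1 q) 1?eq_sym //=.
rewrite !mxE tpermL tpermR.
have -> : \sum_(i | (i != p) && (i != q))
   (col_perm (tperm p q) (Vval v)) 0 i * i%:R =
   \sum_(i | (i != p) && (i != q)) Vval v 0 i * i%:R.
  by apply: eq_bigr => i /andP[ip iq]; rewrite mxE tpermD // eq_sym.
have -> : q%:R = p%:R + 1 :> R[i] by rewrite -(natrD _ p 1) addn1.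
by move: (\sum_(_ | _) _) => s; ring.
Qed.

Fact hone_neq0 : hscal R n 1 != hscal R n 0 :> hecke R n.
Proof. by apply/eqP=> /hclsP/htriv_heq /eqP; rewrite oner_eq0. Qed.

End HeckeAxioms.

HB.instance Definition _ (R : realType) (n : nat) :=
  GRing.isZmodule.Build (hecke R n)
    (@haddA R n) (@haddC R n) (@hadd0 R n) (@haddN R n).
HB.instance Definition _ (R : realType) (n : nat) :=
  GRing.Zmodule_isNzRing.Build (hecke R n)
    (@hmulA R n) (@hmul1 R n) (@hmulr1 R n) (@hmulDl R n) (@hmulDr R n)
    (@hone_neq0 R n).

Definition hscale (R : realType) (n : nat) (c : R[i]) (x : hecke R n) :
  hecke R n := hscal R n c * x.

Section HeckeScale.
Context (R : realType) (n : nat).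
Implicit Types (c d : R[i]) (x y : hecke R n).

Fact hscaleA c d x : hscale c (hscale d x) = hscale (c * d) x.
Proof. by rewrite /hscale hscalM mulrA. Qed.
Fact hscale1 : left_id 1 (@hscale R n).
Proof. exact: mul1r. Qed.
Fact hscaleDr : right_distributive (@hscale R n) +%R.
Proof. by move=> c x y; rewrite /hscale mulrDr. Qed.
Fact hscaleDl x : {morph (@hscale R n)^~ x : c d / c + d}.
Proof. by move=> c d; rewrite /hscale hscalD mulrDl. Qed.
Fact hscaleAl c x y : hscale c (x * y) = hscale c x * y.
Proof. exact: mulrA. Qed.
Fact hscaleAr c x y : hscale c (x * y) = x * hscale c y.
Proof.
by rewrite /hscale mulrA [hscal R n c * x](hscalC c x) -mulrA.
Qed.

End HeckeScale.

HB.instance Definition _ (R : realType) (n : nat) :=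
  GRing.Zmodule_isLmodule.Build R[i] (hecke R n)
    (@hscaleA R n) (@hscale1 R n) (@hscaleDr R n) (@hscaleDl R n).
HB.instance Definition _ (R : realType) (n : nat) :=
  GRing.LSemiModule_isLSemiAlgebra.Build R[i] (hecke R n) (@hscaleAl R n).
HB.instance Definition _ (R : realType) (n : nat) :=
  GRing.LSemiAlgebra_isSemiAlgebra.Build R[i] (hecke R n) (@hscaleAr R n).

Definition hT (R : realType) (n : nat) (w : 'S_n) : hecke R n := hcls (HT w).
Definition hV (R : realType) (n : nat) (v : Vsp R[i] n) : hecke R n :=
  hcls (HV v).
Arguments hT R {n} w.

Section HeckeRelations.
Context (R : realType) (n : nat).
Implicit Types (v : Vsp R[i] n).

Lemma hclsDE (a b : hterm R n) : hcls (HAdd a b) = hcls a + hcls b.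
Proof. by rewrite -hclsD. Qed.
Lemma hclsME (a b : hterm R n) : hcls (HMul a b) = hcls a * hcls b.
Proof. by rewrite -hclsM. Qed.
Lemma hclsZE (c : R[i]) : hcls (HScal c) = c%:A :> hecke R n.
Proof. by rewrite -[LHS]mulr1. Qed.
Lemma hT1 : hT R (1%g : 'S_n) = 1.
Proof. exact/hclsP/heq_T1. Qed.
Lemma hTM (w w' : 'S_n) : hT R (w * w')%g = hT R w * hT R w'.
Proof. by rewrite /hT -hclsME; apply/esym/hclsP/heq_TM. Qed.
Lemma hV_linear : linear (@hV R n).
Proof.
by move=> c u v; rewrite -mulr_algl -hclsZE -hclsME -hclsDE; apply/hclsP/heq_linV.
Qed.
HB.instance Definition _ :=
  GRing.isLinear.Build R[i] (Vsp R[i] n) (hecke R n) _ (@hV R n) hV_linear.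
Lemma hVC u v : hV u * hV v = hV v * hV u.
Proof. by rewrite -!hclsME; apply/hclsP/heq_VC. Qed.
Lemma hV_cross (j : 'I_n.-1) v :
  hV v * hT R (simple_refl j)
    - hT R (simple_refl j) * hV (actV (simple_refl j) v)
  = (dotV (simple_root _ j) v)%:A.
Proof.
apply/eqP; rewrite subr_eq addrC -hclsZE -!hclsME -hclsDE; apply/eqP/hclsP.
exact: heq_cross.
Qed.

End HeckeRelations.

(* On complex vectors, omega^* = - t_w0 w0(conj omega) t_w0 is the
   conjugate-linear extension of the formula for real ones (see hstarV). *)
Fixpoint hterm_star (R : realType) (n : nat) (a : hterm R n) : hterm R n :=
  match a with
  | HScal c => HScal c^*
  | HT w => HT w^-1%g
  | HV v => HMul (HScal (-1)) (HMul (HT (longest n))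
              (HMul (HV (actV (longest n) (conjV v))) (HT (longest n))))
  | HAdd a b => HAdd (hterm_star a) (hterm_star b)
  | HMul a b => HMul (hterm_star b) (hterm_star a)
  end.

Section Star.
Context (R : realType) (n : nat).
Local Notation w0 := (longest n).

Fact longestK : (w0 * w0 = 1)%g.
Proof. by apply/permP=> i; rewrite permM !permE rev_ordK. Qed.

Fact longestV : (w0^-1 = w0)%g.
Proof. by apply/eqP; rewrite eq_invg_mul longestK. Qed.

Fact conjV_act w (v : Vsp R[i] n) : conjV (actV w v) = actV w (conjV v).
Proof. by apply/val_inj/rowP=> i; rewrite !mxE. Qed.

Fact conjVK : involutive (@conjV R n).
Proof. by move=> v; apply/val_inj/rowP=> i; rewrite !mxE conjCK. Qed.

Fact rev_simple_subproof (j : 'I_n.-1) : (n.-2 - j < n.-1)%N.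
Proof. by case: n j => [|[|k]] [j] //= _; rewrite ltnS leq_subr. Qed.

Fact longest_cur (j : 'I_n.-1) :
  w0 (curord j) = sucord (Ordinal (rev_simple_subproof j)).
Proof.
rewrite permE; apply: val_inj => /=; case: n j => [|[|k]] [j] //= jk.
by rewrite subSS subSn // -ltnS.
Qed.

Fact longest_suc (j : 'I_n.-1) :
  w0 (sucord j) = curord (Ordinal (rev_simple_subproof j)).
Proof.
rewrite permE; apply: val_inj => /=; case: n j => [|[|k]] [j] //= jk.
Qed.

Fact simple_refl_longest (j : 'I_n.-1) :
  (w0 * simple_refl j)%g =
  (simple_refl (Ordinal (rev_simple_subproof j)) * w0)%g.
Proof.
rewrite /simple_refl -longest_cur -longest_suc [in RHS]tpermC -tpermJ.
by rewrite /conjg longestV -!mulgA longestK mulg1.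
Qed.

Fact conj_dot_root (j : 'I_n.-1) (v : Vsp R[i] n) :
  dotV (simple_root _ j) (conjV v) = (dotV (simple_root _ j) v)^*.
Proof. by rewrite !dotV_root !mxE rmorphB. Qed.

Lemma hterm_star_heq (a b : hterm R n) :
  heq a b -> heq (hterm_star a) (hterm_star b).
Proof.
elim=> {a b} /=.
- by move=> *; apply: heq_refl.
- by move=> *; apply: heq_sym.
- by move=> b a c _ h1 _ h2; apply: heq_trans h1 h2.
- by move=> *; apply: heq_add.
- by move=> *; apply: heq_mul.
- by move=> *; apply: heq_addA.
- by move=> *; apply: heq_addC.
- by move=> *; rewrite rmorph0; apply: heq_add0.
- by move=> *; apply/heq_sym/heq_mulA.
- move=> *; rewrite rmorph1; apply: (heq_trans (heq_sym (heq_scalC _ _))).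
  exact: heq_mul1.
- move=> *; rewrite rmorph0; apply: (heq_trans (heq_sym (heq_scalC _ _))).
  exact: heq_mul0.
- by move=> *; apply: heq_mulDr.
- by move=> *; apply: heq_mulDl.
- by move=> *; rewrite rmorphD; apply: heq_scalD.
- by move=> *; rewrite rmorphM mulrC; apply: heq_scalM.
- by move=> *; apply/heq_sym/heq_scalC.
- move=> c u v; apply/hclsP; rewrite !(hclsDE, hclsME, hclsZE).
  rewrite -/(hT R w0) -!/(hV _).
  have -> : actV w0 (conjV (c *: u + v)) =
    c^* *: actV w0 (conjV u) + actV w0 (conjV v).
    by apply/val_inj/rowP=> i; rewrite !mxE rmorphD rmorphM.
  rewrite linearP mulr_algr !mulr_algl mulrDl mulrDr scalerDr.
  by rewrite -!scalerAl -!scalerAr scalerA mulrC -scalerA.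
- by rewrite invg1 rmorph1; apply: heq_T1.
- by move=> w w'; rewrite invMg; apply: heq_TM.
- move=> u v; apply/hclsP; rewrite !(hclsDE, hclsME, hclsZE) !mulr_algl.
  rewrite -/(hT R w0) -!/(hV _).
  rewrite -!scalerAl -!scalerAr; do 2 congr (_ *: _).
  have E x y : hT R w0 * (x * hT R w0) * (hT R w0 * (y * hT R w0)) =
     hT R w0 * (x * y) * hT R w0.
    by rewrite !mulrA -[X in X * y]mulrA -hTM longestK hT1 mulr1.
  by rewrite !E hVC.
move=> j v; apply/hclsP; rewrite !(hclsDE, hclsME, hclsZE) !mulr_algl.
rewrite -/(hT R w0) -!/(hV _) /simple_refl tpermV -/(simple_refl j).
rewrite -!/(hT R (simple_refl j)).
set s := simple_refl j; set k := Ordinal (rev_simple_subproof j).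
set t := simple_refl k.
rewrite conjV_act -actVM simple_refl_longest actVM -/k -/t.
set u := actV w0 (conjV v).
have Es : hT R w0 * hT R s = hT R t * hT R w0.
  by rewrite -!hTM simple_refl_longest.
have Es' : hT R s * hT R w0 = hT R w0 * hT R t.
  rewrite -!hTM; congr hT; apply: (mulgI w0); rewrite !mulgA longestK mul1g.
  by rewrite simple_refl_longest -/k -/t -mulgA longestK mulg1.
have tt : actV t (actV t u) = u by rewrite -actVM tperm2 actV1.
have := hV_cross k (actV t u); rewrite -/t tt => /eqP.
rewrite subr_eq => /eqP H.
have D : dotV (simple_root _ k) (actV t u) = (dotV (simple_root _ j) v)^*.
  rewrite -conj_dot_root !dotV_root !mxE tpermL tpermR.
  by rewrite -!longest_cur -!longest_suc -!permM !longestK !perm1.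
rewrite -scalerAr -scalerAl !scaleN1r.
have -> : hT R s * (hT R w0 * (hV u * hT R w0)) =
    hT R w0 * (hT R t * hV u * hT R w0) by rewrite mulrA Es' !mulrA.
have -> : hT R w0 * (hV (actV t u) * hT R w0) * hT R s =
    hT R w0 * (hV (actV t u) * hT R t * hT R w0) by rewrite -!mulrA Es.
rewrite H D mulrDl mulrDr mulr_algl -scalerAr -hTM longestK hT1.
by rewrite opprD addrAC addNr add0r.
Qed.

End Star.

Definition hstar (R : realType) (n : nat) (x : hecke R n) : hecke R n :=
  hcls (hterm_star (repr x)).

Section StarTheory.
Context (R : realType) (n : nat).
Implicit Types (x y : hecke R n).

Fact hstar_cls (a : hterm R n) : hstar (hcls a) = hcls (hterm_star a).
Proof. by apply/hclsP/hterm_star_heq/hclsP; rewrite hcls_repr. Qed.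

Lemma hstarD x y : hstar (x + y) = hstar x + hstar y.
Proof.
elim/hcls_ind: x => a; elim/hcls_ind: y => b.
by rewrite -hclsDE !hstar_cls -hclsDE.
Qed.

Lemma hstarM x y : hstar (x * y) = hstar y * hstar x.
Proof.
elim/hcls_ind: x => a; elim/hcls_ind: y => b.
by rewrite -hclsME !hstar_cls -hclsME.
Qed.

Lemma hstarZ (c : R[i]) x : hstar (c *: x) = c^* *: hstar x.
Proof.
by rewrite -mulr_algl -hclsZE hstarM hstar_cls hclsZE mulr_algr.
Qed.

Lemma hstarT (w : 'S_n) : hstar (hT R w) = hT R w^-1%g.
Proof. exact: hstar_cls. Qed.

Lemma hstarV (v : Vsp R n) :
  hstar (hV (complexV v)) =
  - (hT R (longest n) * hV (actV (longest n) (complexV v)) * hT R (longest n)).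
Proof.
rewrite hstar_cls /= !hclsME hclsZE mulr_algl scaleN1r mulrA.
congr (- (_ * hV (actV _ _) * _)).
by apply/val_inj/rowP=> i; rewrite !mxE conj_Creal // complex_real.
Qed.

Lemma hstarK : involutive (@hstar R n).
Proof.
elim/hcls_ind; elim=> [c|w|v|a IHa b IHb|a IHa b IHb].
- by rewrite !hstar_cls /= conjCK.
- by rewrite !hstar_cls /= invgK.
- rewrite !hstar_cls /= !hclsME !hclsZE.
  rewrite rmorphN rmorph1 longestV conjV_act conjVK -actVM longestK actV1.
  rewrite mulr_algr !mulr_algl -!scalerAr -scalerAl scalerA mulrN1 opprK scale1r.
  rewrite -![hcls (HT _)]/(hT R _) !mulrA -hTM longestK hT1 mul1r -mulrA -hTM.
  by rewrite longestK hT1 mulr1.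
- by rewrite hclsDE !hstarD IHa IHb.
- by rewrite hclsME !hstarM IHa IHb.
Qed.

End StarTheory.

(* The scalar c in C acts on an H-module by c%:A. *)

Definition simple_hmod (R : realType) (n : nat) (X : lmodType (hecke R n)) :
  Prop :=
  (exists x : X, x != 0) /\
  forall S : {pred X}, GRing.submod_closed S -> S =i pred1 0 \/ S =i predT.

Definition star_hermitian (R : realType) (n : nat) (X : lmodType (hecke R n)) :
  Prop :=
  exists form : X -> X -> R[i],
    [/\ forall c x y z, form (c%:A *: x + y) z = c * form x z + form y z,
        forall x y, form y x = (form x y)^*,
        forall x, (forall y, form x y = 0) -> x = 0
      & forall a x y, form (a *: x) y = form x (hstar a *: y)].

Definition restriction_irreducible (R : realType) (n : nat)
    (X : lmodType (hecke R n)) : Prop :=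
  (exists x : X, x != 0) /\
  forall S : {pred X},
    [/\ 0 \in S,
        forall (c : R[i]) x y, x \in S -> y \in S -> c%:A *: x + y \in S
      & forall w x, x \in S -> hT R w *: x \in S] ->
    S =i pred1 0 \/ S =i predT.

Definition one_W_type (R : realType) (n : nat) (X : lmodType (hecke R n)) :
  Prop :=
  [/\ simple_hmod X, star_hermitian X & restriction_irreducible X].

(* The group algebra F[S_n], as functions under convolution. *)
Definition gconv (F : fieldType) (n : nat) (a b : {ffun 'S_n -> F}) :
  {ffun 'S_n -> F} := [ffun w => \sum_u a u * b (u^-1 * w)%g].

Definition gdelta (F : fieldType) (n : nat) (u : 'S_n) : {ffun 'S_n -> F} :=
  [ffun w => (w == u)%:R].

(* Row and column stabilizers of the tableau of shape la whose rows are filled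
   successively with 0, 1, 2, ... from left to right. *)
Definition row_stab (n : nat) (la : seq nat) : {set 'S_n} :=
  [set w : 'S_n | [forall k, reshape_index la (w k) == reshape_index la k]].
Definition col_stab (n : nat) (la : seq nat) : {set 'S_n} :=
  [set w : 'S_n | [forall k, reshape_offset la (w k) == reshape_offset la k]].

Definition young_symmetrizer (F : fieldType) (n : nat) (la : seq nat) :
  {ffun 'S_n -> F} :=
  [ffun w => \sum_(p in row_stab n la) \sum_(q in col_stab n la)
               (-1) ^+ q * gdelta F (p * q)%g w].

(* The representation parameterized by la is the left ideal generated by the
   Young symmetrizer; (n) gives the trivial representation.  Passing to the
   opposite product of permutations yields an isomorphic representation. *)
Definition young_ideal (F : fieldType) (n : nat) (la : seq nat) :
  {ffun 'S_n -> F} -> Prop :=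
  fun a => exists b, a = gconv b (young_symmetrizer F n la).

Definition restriction_iso (R : realType) (n : nat) (X : lmodType (hecke R n))
    (la : seq nat) : Prop :=
  exists phi : X -> {ffun 'S_n -> R[i]},
    [/\ forall c x y w, phi (c%:A *: x + y) w = c * phi x w + phi y w,
        forall u x, phi (hT R u *: x) = gconv (gdelta R[i] u) (phi x),
        injective phi
      & forall a, young_ideal la a <-> exists x, phi x = a].

(* S(V_C) is the polynomial ring on the basis of V_C given by the simple roots:
   the variable 'X_j stands for simple_root j. *)

(* The image of V_C in S(V_C); see symV_coord for the coordinates. *)
Definition symV (R : realType) (n : nat) (v : Vsp R[i] n) :
  {mpoly R[i][n.-1]} :=
  \sum_(j < n.-1) (\sum_(i < n | (i <= j)%N) Vval v 0 i) *: 'X_j.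

Lemma symV_coord (F : fieldType) (n : nat) (v : Vsp F n) :
  v = \sum_(j < n.-1) (\sum_(i < n | (i <= j)%N) Vval v 0 i)
        *: simple_root F j.
Proof.
case: n v => [|n] v; first by apply/val_inj/rowP=> - [].
pose C k := \sum_(i < n.+1 | (i < k)%N) Vval v 0 i.
have C0 : C 0%N = 0 by rewrite /C big1.
have Cn : C n.+1 = 0.
  rewrite /C -[RHS](eqP (VvalP v)); apply: eq_bigl => i; exact: ltn_ord.
have CS (k : 'I_n.+1) : C k.+1 - C k = Vval v 0 k.
  rewrite /C (bigD1 k) //= -[RHS]addr0 -addrA; congr (_ + _).
  apply/eqP; rewrite subr_eq0; apply/eqP/eq_bigl => i.
  by rewrite ltnS ltn_neqAle andbC -val_eqE.
apply: val_inj; rewrite raddf_sum /=; apply/rowP=> k; rewrite summxE.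
under eq_bigr => j _.
  rewrite !mxE eqxx /= mulrBr -[X in X * _ - _]/(C j.+1) -[X in _ - X * _]/(C j.+1).
  over.
rewrite -CS sumrB; congr (_ - _).
- have E (j : 'I_n) : (k == curord (j : 'I_n.+1.-1)) = (j == k :> nat).
    by rewrite -val_eqE eq_sym.
  under eq_bigr do rewrite E.
  case: (ltnP k n) => kn.
    rewrite (bigD1 (Ordinal kn)) //= eqxx mulr1 big1 ?addr0 // => j.
    by rewrite -val_eqE => /negPf /= ->; rewrite mulr0.
  have -> : k = n :> nat by apply/eqP; rewrite eqn_leq kn -ltnS ltn_ord.
  by rewrite Cn big1 // => j _; rewrite ltn_eqF ?mulr0.
have E (j : 'I_n) : (k == sucord (j : 'I_n.+1.-1)) = (j.+1 == k :> nat).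
  by rewrite -val_eqE eq_sym.
under eq_bigr do rewrite E.
case: k {E} => - [|k] kn /=; first by rewrite C0 big1 // => j _; rewrite mulr0.
rewrite (bigD1 (Ordinal (kn : (k < n)%N))) //= eqxx mulr1 big1 ?addr0 // => j.
by rewrite -val_eqE eqSS => /negPf /= ->; rewrite mulr0.
Qed.

Definition sym_act (R : realType) (n : nat) (w : 'S_n)
    (f : {mpoly R[i][n.-1]}) : {mpoly R[i][n.-1]} :=
  f \mPo [tuple symV (actV w (simple_root R[i] j)) | j < n.-1].

Definition sym_hecke (R : realType) (n : nat) (f : {mpoly R[i][n.-1]}) :
  hecke R n :=
  mmap (in_alg (hecke R n)) (fun j => hV (simple_root R[i] j)) f.

Lemma sym_hecke_symV (R : realType) (n : nat) (v : Vsp R[i] n) :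
  sym_hecke (symV v) = hV v.
Proof.
rewrite [in RHS](symV_coord v) linear_sum /sym_hecke /symV raddf_sum /=.
by apply: eq_bigr => j _; rewrite mmapZ mmapX mmap1U linearZ /= mulr_algl.
Qed.

(* The value at nu of f, as a polynomial function on V_C^* = V_C. *)
Definition sym_eval (R : realType) (n : nat) (f : {mpoly R[i][n.-1]})
    (nu : Vsp R[i] n) : R[i] :=
  f.@[fun j => dotV (simple_root R[i] j) nu].

(* The center of the algebra is (the image of) S(V_C)^W, so this says that it
   acts on X through chi_nu : f |-> f(nu). *)
Definition has_central_character (R : realType) (n : nat)
    (X : lmodType (hecke R n)) (nu : Vsp R[i] n) : Prop :=
  forall f : {mpoly R[i][n.-1]}, (forall w : 'S_n, sym_act w f = f) ->
  forall x : X, sym_hecke f *: x = (sym_eval f nu)%:A *: x.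

Definition jordan_nilp (F : fieldType) (n : nat) (la : seq nat) : 'M[F]_n :=
  \matrix_(i, j) ((j == i.+1 :> nat) &&
                  (reshape_index la i == reshape_index la j))%:R.

Definition nilp_orbit (F : fieldType) (n : nat) (la : seq nat) (e : 'M[F]_n) :
  Prop :=
  sumn la = n /\
  exists2 P, P \in unitmx & e = invmx P *m jordan_nilp F n la *m P.

Definition lie_bracket (F : fieldType) (n : nat) (a b : 'M[F]_n) : 'M[F]_n :=
  a *m b - b *m a.

(* e, f are traceless by the bracket relations. *)
Definition lie_triple (F : fieldType) (n : nat) (e h f : 'M[F]_n) : Prop :=
  [/\ lie_bracket h e = 2 *: e,
      lie_bracket h f = - 2 *: f
    & lie_bracket e f = h].

Definition middle_element (R : realType) (n : nat) (la : seq nat)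
    (h : Vsp R n) : Prop :=
  exists e f : 'M[R[i]]_n,
    nilp_orbit la e /\ lie_triple e (diag_mx (Vval (complexV h))) f.

(* (d+m-1, d+m-3, ..., |d-m|+1) *)
Definition hook (d m : nat) : seq nat :=
  mkseq (fun i => (d + m).-1 - i.*2)%N (minn d m).

(* Main.v *)
From HB Require Import structures.
Require Import Defs.
From mathcomp Require Import all_boot all_order all_fingroup all_algebra.
From mathcomp Require Import complex boolp reals mpoly ring zify.

(* Let v in X correspond to the Young symmetrizer.  A function on S_n that is
   alternating under the column group and invariant under the symmetric group of
   d + 1 points vanishes (two of the points meet the same column); hence the
   Garnir relations v + sum_(j in a row) t_(i j) v = 0 for i outside the row.
   They show that the Jucys-Murphy element sum_(j < i) t_(i j) acts on v by the
   content of the box i, and that T_i = sum_(j != i) t_(i j) acts on v, hence on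
   all of X, by d - m.

   The element Z(u) = u + sum_(j < i) u_i t_(i j) satisfies
   t_w Z(u) t_w^-1 = Z(w u).  Taking the commutator of the scalar operator T_j
   with Z(e_i - mean) leaves only Z(e_i - mean) = Z(e_j - mean), so Z acts by 0
   on X.  This is the multiplicity of the rectangular sigma in V (x) sigma being
   0, and it makes v an eigenvector of V_C, with weight minus the contents.
   As S(V_C)^W is central and X is simple, this determines the central character.

   In a Jordan basis of e every middle element is triangular with respect to the
   weights of the Jordan blocks (all block sizes are distinct), which gives its
   spectrum; cutting the rectangle into its diagonal hooks identifies this
   spectrum with the shifted contents. *)

Set Implicit Arguments.
Unset Strict Implicit.
Unset Printing Implicit Defensive.
Import Order.TTheory GRing.Theory Num.Theory.
Local Open Scope ring_scope.

(** * The spectrum of a middle element *)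

Lemma big_reshape (M : Type) (idx : M) (op : Monoid.com_law idx)
    (sh : seq nat) (F : nat -> M) :
  \big[op/idx]_(i < sumn sh) F i =
  \big[op/idx]_(r < size sh)
     \big[op/idx]_(c < nth 0%N sh r) F (flatten_index sh r c).
Proof.
elim: sh F => [|l sh IH] F /=; first by rewrite !big_ord0.
rewrite big_split_ord big_ord_recl /=; congr (op _ _).
rewrite (IH (fun i => F (l + i)%N)); apply: eq_bigr => r _.
by apply: eq_bigr => c _; rewrite /flatten_index /= addnA.
Qed.

Section JordanBlocks.
Context (F : numFieldType) (la : seq nat).
Local Notation n := (sumn la).
Local Notation blk := (reshape_index la).
Local Notation off := (reshape_offset la).
Local Notation len i := (nth 0%N la (blk i)).
Local Notation J := (jordan_nilp F n la).
Implicit Types (i j : 'I_n) (A f : 'M[F]_n).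

Lemma off_lt_len i : (off i < len i)%N.
Proof. exact: reshape_offsetP (ltn_ord i). Qed.

Lemma blk_off_inj i j : blk i = blk j -> off i = off j -> i = j.
Proof.
move=> hb ho; apply: val_inj => /=.
by rewrite -(reshape_indexK la i) -(reshape_indexK la j) hb ho.
Qed.

Lemma off_succ (i j : nat) : j = i.+1 -> blk i = blk j -> off j = (off i).+1.
Proof.
move=> ji hb; apply/eqP; rewrite -(eqn_add2l (sumn (take (blk j) la))).
have /eqP := reshape_indexK la j; rewrite /flatten_index => /eqP ->.
by rewrite addnS -hb -[(_ + _)%N]/(flatten_index la (blk i) (off i)) reshape_indexK ji.
Qed.

Lemma ord_next i : ((off i).+1 < len i)%N ->
  exists j, [/\ j = i.+1 :> nat, blk i = blk j & off j = (off i).+1].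
Proof.
move=> lt_c.
have Ei : flatten_index la (blk i) (off i).+1 = i.+1.
  rewrite /flatten_index addnS.
  by rewrite -[(_ + off i)%N]/(flatten_index la (blk i) (off i)) reshape_indexK.
have lt_n : (i.+1 < n)%N by rewrite -Ei flatten_indexP.
exists (Ordinal lt_n); split => //=; rewrite -Ei.
  by rewrite flatten_indexKl.
by rewrite flatten_indexKr.
Qed.

Lemma ord_prev j : (0 < off j)%N ->
  exists i, [/\ j = i.+1 :> nat, blk i = blk j & off j = (off i).+1].
Proof.
move=> off_gt0; have := off_lt_len j.
have Ej := reshape_indexK la j; rewrite -(prednK off_gt0) in Ej *.
move=> lt_c; have lt_c' := ltnW lt_c.
have Ej' : (j : nat) = (flatten_index la (blk j) (off j).-1).+1.
  by rewrite -[LHS]Ej /flatten_index addnS.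
have lt_n : (flatten_index la (blk j) (off j).-1 < n)%N.
  exact: flatten_indexP.
exists (Ordinal lt_n); split => //=; first by rewrite flatten_indexKl.
by rewrite flatten_indexKr.
Qed.

Lemma jordan_mull_next A i i' j : i' = i.+1 :> nat -> blk i = blk i' ->
  (J *m A) i j = A i' j.
Proof.
move=> Ei hb; rewrite mxE (bigD1 i') //= mxE Ei eqxx -[i.+1]Ei hb eqxx mul1r.
rewrite big1 ?addr0 // => k; rewrite -val_eqE /= => ki.
by rewrite mxE -Ei (negPf ki) mul0r.
Qed.

Lemma jordan_mull_last A i j : (off i).+1 = len i -> (J *m A) i j = 0.
Proof.
move=> hi; rewrite mxE big1 // => k _; rewrite mxE.
case: andP => [[/eqP ki /eqP hb]|_]; last by rewrite mul0r.
by have := off_lt_len k; rewrite (off_succ ki hb) -hb hi ltnn.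
Qed.

Lemma jordan_mulr_next A i j j' : j' = j.+1 :> nat -> blk j = blk j' ->
  (A *m J) i j' = A i j.
Proof.
move=> Ej hb; rewrite mxE (bigD1 j) //= mxE Ej eqxx -[j.+1]Ej hb eqxx mulr1.
rewrite big1 ?addr0 // => k; rewrite -val_eqE /= => ki.
by rewrite mxE Ej eqSS eq_sym (negPf ki) mulr0.
Qed.

Lemma jordan_mulr_first A i j : off j = 0%N -> (A *m J) i j = 0.
Proof.
move=> hj; rewrite mxE big1 // => k _; rewrite mxE.
case: andP => [[/eqP ki /eqP hb]|_]; last by rewrite mulr0.
by have := off_succ ki hb; rewrite hj.
Qed.

(** Diagonal entry at [i] of the standard middle element of [J]: down a block of length l it runs
    through l - 1, l - 3, ..., 1 - l. *)
Definition jordan_weight (i : nat) : int := (len i)%:Z - 1 - 2 * (off i)%:Z.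

Section MiddleElement.
Context (h f : 'M[F]_n).
Hypothesis (hJ : lie_bracket h J = 2 *: J) (Jf : lie_bracket J f = h).

Lemma bracket_entry i j :
  (h *m J) i j - (J *m h) i j = 2 * J i j.
Proof. by have /matrixP/(_ i j) := hJ; rewrite !mxE. Qed.

(** This is entry (i, j') of [h, J] = 2J: multiplying by J on the right moves column j to j', on the
    left row i' to i. *)
Lemma middle_shift i j i' j' : i' = i.+1 :> nat -> blk i = blk i' ->
  j' = j.+1 :> nat -> blk j = blk j' -> h i' j' = h i j - 2 * (i == j)%:R.
Proof.
move=> Ei hbi Ej hbj; have := bracket_entry i j'.
rewrite (jordan_mulr_next _ _ Ej hbj) (jordan_mull_next _ _ Ei hbi) mxE Ej eqSS.
have -> : ((j : nat) == i) && (blk i == blk j.+1) = (i == j).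
  rewrite -[j.+1]Ej -hbj; apply/andP/eqP => [[/eqP ji _]|->].
    exact/esym/val_inj.
  by rewrite !eqxx.
by move=> E; rewrite -E; ring.
Qed.

(** [middle_shift] slides both indices back until the column starts its block. There h J has a zero
    column, and [h, J] = 2J kills the entry. *)
Lemma middle_lower i j : (off j < off i)%N -> h i j = 0.
Proof.
move Ek : (off j) => k; elim: k i j Ek => [|k IH] i j Ek lt_k.
  have [i0 [Ei hb _]] := ord_prev lt_k.
  have := bracket_entry i0 j.
  rewrite (jordan_mulr_first _ _ Ek) (jordan_mull_next _ _ Ei hb) mxE.
  case: andP => [[/eqP ji hb']|_].
    have ij : i = j by apply: val_inj; rewrite /= ji.
    by rewrite ij Ek in lt_k.
  by rewrite mulr0 sub0r => /eqP; rewrite oppr_eq0 => /eqP.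
have [i0 [Ei hbi oi]] := ord_prev (leq_ltn_trans (leq0n _) lt_k).
have [|j0 [Ej hbj oj]] := @ord_prev j; first by rewrite Ek.
have kj : off j0 = k by move: oj; rewrite Ek => -[].
rewrite (middle_shift Ei hbi Ej hbj) IH //; last by rewrite oi ltnS in lt_k.
case: eqP => [ij|_]; last by rewrite mulr0 subr0.
by move: lt_k; rewrite oi ij kj ltnn.
Qed.

(** Mirror image of [middle_lower]: the indices slide forward until the row ends its block, where J
    h has a zero row. *)
Lemma middle_last i j : (len i - off i < len j - off j)%N -> h i j = 0.
Proof.
move Ek : (len i - off i)%N => k; elim: k i j Ek => [|k IH] i j Ek lt_k.
  by have := off_lt_len i; rewrite -subn_gt0 Ek.
have [|j0 [Ej hbj oj]] := @ord_next j.
  by rewrite -subn_gt0 subnS -ltnS prednK; lia.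
have [lt_c|ge_c] := ltnP (off i).+1 (len i).
  have [i0 [Ei hbi oi]] := ord_next lt_c.
  have := middle_shift Ei hbi Ej hbj.
  have -> : h i0 j0 = 0 by apply: IH; rewrite -?hbi -?hbj ?oi ?oj; lia.
  case: eqP => [ij|_]; first by subst j; lia.
  by rewrite mulr0 subr0.
have := bracket_entry i j0.
rewrite (jordan_mulr_next _ _ Ej hbj) jordan_mull_last; last first.
  by have := off_lt_len i; lia.
rewrite mxE; case: andP => [[/eqP ji /eqP hb]|_]; last by rewrite mulr0 subr0.
have ij : i = j by apply: val_inj => /=; move: ji; rewrite Ej => -[].
by move: lt_k; rewrite -ij; lia.
Qed.

(* A nonzero entry needs off i <= off j and len j - off j <= len i - off i, and
   the difference of the two weights is the sum of the two gaps. *)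
Lemma middle_triangular i j : uniq la -> i != j -> h i j != 0 ->
  jordan_weight j < jordan_weight i.
Proof.
move=> ula ij hij.
have le_o : (off i <= off j)%N.
  by rewrite leqNgt; apply: contraNN hij => /middle_lower ->.
have le_l : (len j - off j <= len i - off i)%N.
  by rewrite leqNgt; apply: contraNN hij => /middle_last ->.
have oi := off_lt_len i; have oj := off_lt_len j.
rewrite /jordan_weight.
have [Eo|neo] := eqVneq (off i) (off j); last by lia.
(* If both gaps vanish, the blocks have equal length, so they coincide because the parts are
   distinct. *)
have [El|] := eqVneq (len i) (len j); last by lia.
case/eqP: ij; apply: blk_off_inj => //.
by apply/eqP; rewrite -(nth_uniq 0%N _ _ ula) ?reshape_indexP ?El.
Qed.

(** J is block diagonal, so it commutes with the projection p to block r, and the trace of p [J, f]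
    is zero. *)
Lemma middle_block_trace (r : nat) : \sum_(i : 'I_n | blk i == r) h i i = 0.
Proof.
pose g i j : F := (blk i == r)%:R * (J i j * f j i).
have gE i j : g j i = (blk i == r)%:R * (J j i * f i j).
  rewrite /g mxE; case: andP => [[_ /eqP ->]|_] //.
  by rewrite !mul0r !mulr0.
have -> : \sum_(i : 'I_n | blk i == r) h i i = \sum_i (\sum_j g i j - \sum_j g j i).
  rewrite big_mkcond; apply: eq_bigr => i _ /=.
  under [X in _ - X]eq_bigr do rewrite gE.
  rewrite -!mulr_sumr -mulrBr -Jf; case: ifP => _; rewrite ?mul0r // mul1r.
  rewrite !mxE; congr (_ - _); apply: eq_bigr => j _; exact: mulrC.
by rewrite sumrB [X in _ - X]exchange_big /= subrr.
Qed.

(** By [middle_shift], h i i + 2 off i is constant on a block of length l; the vanishing block trace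
    makes this constant l - 1. *)
Lemma middle_diag i : h i i = (jordan_weight i)%:~R.
Proof.
pose b i := h i i + 2 * (off i)%:R.
have bS i' i0 : i' = i0.+1 :> nat -> blk i0 = blk i' -> b i' = b i0.
  move=> Ei hb; rewrite /b (middle_shift Ei hb Ei hb) eqxx (off_succ Ei hb).
  by rewrite -natr1 mulr1n; ring.
have bE i1 i2 : blk i1 = blk i2 -> b i1 = b i2.
  suff H k : forall i1 i2, off i1 = k -> blk i1 = blk i2 ->
      (off i1 <= off i2)%N -> b i1 = b i2.
    by move=> hb; case: (leqP (off i1) (off i2)) => [|/ltnW] /H;
      [apply | move=> E; apply/esym/E].
  move=> {i1 i2} i1 i2 Ek; move El : (off i2 - k)%N => l.
  elim: l i2 El => [|l IH] i2 El hb le_o.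
    by congr b; apply: blk_off_inj => //; lia.
  have [|i3 [E3 hb3 o3]] := @ord_prev i2; first by lia.
  by rewrite (bS _ _ E3 hb3); apply: IH; rewrite ?hb3 //; lia.
have := middle_block_trace (blk i).
under eq_bigr => j /eqP hj.
  have -> : h j j = b i - 2 * (off j)%:R.
    by rewrite -(bE j i) // /b addrK.
  over.
rewrite big_mkcond.
rewrite (big_reshape _ _ (fun k => if blk k == blk i then b i - 2 * (off k)%:R else 0)).
have lt_r := reshape_indexP (ltn_ord i).
rewrite (bigD1 (Ordinal lt_r)) //= [X in _ + X]big1 ?addr0; last first.
  move=> r; rewrite -val_eqE /= => ne_r; apply: big1 => c _.
  by rewrite flatten_indexKl // (negPf ne_r).
under eq_bigr do rewrite flatten_indexKl // flatten_indexKr // eqxx.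
have tri (l : nat) : \sum_(c < l) 2 * (c : nat)%:R = l%:R * (l%:R - 1) :> F.
  elim: l => [|l IHl]; first by rewrite big_ord0 mul0r.
  by rewrite big_ord_recr IHl /= -natr1; ring.
rewrite sumrB sumr_const card_ord tri -[b i *+ _]mulr_natl -mulrBr => /eqP.
have := off_lt_len i => oi.
rewrite mulf_eq0 pnatr_eq0 (gtn_eqF (leq_ltn_trans (leq0n _) oi)) /= subr_eq0.
move=> /eqP bl; rewrite -[LHS](addrK (2 * (off i)%:R)) -/(b i) bl /jordan_weight.
by rewrite !rmorphB /= rmorphM /=.
Qed.

(** In the Leibniz expansion, a nonzero term of a permutation s <> 1 would lower the weight at every
    moved index, although s preserves the total weight. Only the diagonal term survives. *)
Lemma middle_char_poly : uniq la ->
  char_poly h = \prod_(i : 'I_n) ('X - ((jordan_weight i)%:~R)%:P).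
Proof.
move=> ula; rewrite /char_poly /determinant (bigD1 1%g) //= odd_perm1 mul1r.
rewrite [X in _ + X]big1 ?addr0 => [|s s_neq1].
  by apply: eq_bigr => i _; rewrite perm1 !mxE eqxx middle_diag.
apply/eqP; rewrite mulf_eq0; apply/orP; right.
apply/negPn; rewrite prodf_seq_neq0 /=; apply/negP => /allP nz.
have hnz (i : 'I_n) : s i != i -> h i (s i) != 0.
  move=> si; apply: contraTneq (nz i (mem_index_enum _)) => hi0.
  by rewrite !mxE hi0 [i == _]eq_sym (negPf si) mulr0n sub0r oppr0 eqxx.
have [i0 si0] : exists i, s i != i.
  apply/existsP; rewrite -negb_forall; apply: contra s_neq1 => /forallP Es.
  by apply/eqP/permP => i; rewrite perm1; exact/eqP.
have le_w (i : 'I_n) : jordan_weight (s i) <= jordan_weight i.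
  have [-> //|si] := eqVneq (s i) i.
  by apply/ltW/middle_triangular; rewrite ?hnz // eq_sym.
have : \sum_(i : 'I_n) jordan_weight (s i) < \sum_(i : 'I_n) jordan_weight i.
  rewrite (bigD1 i0) //= [ltRHS](bigD1 i0) //= ltr_leD ?ler_sum //.
  by rewrite middle_triangular ?hnz // eq_sym.
by rewrite [ltRHS](reindex_inj (@perm_inj _ s)) ltxx.
Qed.

End MiddleElement.
End JordanBlocks.

(* For fixed s the left side runs over the hook of the d x m rectangle with
   corner (s, s). *)
Lemma big_hook (M : Type) (idx : M) (op : Monoid.com_law idx) (G : int -> M)
    (d m : nat) :
  \big[op/idx]_(s < minn d m) \big[op/idx]_(k < ((d + m).-1 - s.*2)%N)
      G (((d + m).-1 - s.*2)%N%:Z - 1 - 2 * k%:Z) =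
  \big[op/idx]_(r < m) \big[op/idx]_(c < d) G (d%:Z - m%:Z - 2 * (c%:Z - r%:Z)).
Proof.
elim: m d => [|m IH] [|d].
- by rewrite minn0 !big_ord0.
- by rewrite minn0 !big_ord0.
- by rewrite min0n big_ord0 big1 // => r _; rewrite big_ord0.
rewrite minnSS big_ord_recl [RHS]big_ord_recl.
under [X in _ = op _ X]eq_bigr do rewrite big_ord_recl.
rewrite big_split /= Monoid.mulmA; congr (op _ _).
  (* The string of the outer hook climbs the first column from its lowest box, whence the reversal
     of the first m terms, and then follows the first row. *)
  have -> : (d + m.+1 - 0.*2 = m + d.+1)%N by lia.
  rewrite big_split_ord [RHS]Monoid.mulmC; congr (op _ _).
    rewrite (reindex_inj rev_ord_inj) /=; apply: eq_bigr => k _; congr G.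
    by rewrite /bump /=; have := ltn_ord k; lia.
  by apply: eq_bigr => k _; congr G; rewrite /=; lia.
(* Deleting the first row and the first column changes neither the contents nor the difference of
   the side lengths. *)
have -> : \big[op/idx]_(r < m) \big[op/idx]_(c < d)
    G (d.+1%:Z - m.+1%:Z - 2 * ((bump 0 c)%:Z - (bump 0 r)%:Z)) =
  \big[op/idx]_(r < m) \big[op/idx]_(c < d) G (d%:Z - m%:Z - 2 * (c%:Z - r%:Z)).
  by apply: eq_bigr => r _; apply: eq_bigr => c _; congr G; rewrite /bump /=; lia.
rewrite -IH; apply: eq_bigr => s _ /=.
have -> : (d + m.+1 - (bump 0 s).*2 = (d + m).-1 - s.*2)%N.
  by rewrite /bump /=; lia.
by [].
Qed.

Lemma hook_uniq (d m : nat) : uniq (hook d m).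
Proof.
apply/mkseq_uniqP => i j; rewrite !inE => hi hj.
by lia.
Qed.

(** * Contents of the rectangle and the spectrum of the hook partition *)

Section Content.
Context (d m : nat).
Definition content (i : nat) : int :=
  (reshape_offset (nseq m d) i)%:Z - (reshape_index (nseq m d) i)%:Z.

(** The general monoid law encodes an equality of multisets; products of linear polynomials are the
    instance used. *)
Lemma big_hook_content (M : Type) (idx : M) (op : Monoid.com_law idx)
    (G : int -> M) :
  \big[op/idx]_(i < sumn (hook d m)) G (jordan_weight (hook d m) i) =
  \big[op/idx]_(i < sumn (nseq m d)) G (d%:Z - m%:Z - 2 * content i).
Proof.
rewrite (big_reshape _ _ (fun i => G (jordan_weight (hook d m) i))).
rewrite (big_reshape _ _ (fun i => G (d%:Z - m%:Z - 2 * content i))).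
transitivity (\big[op/idx]_(r < m) \big[op/idx]_(c < d)
   G (d%:Z - m%:Z - 2 * (c%:Z - r%:Z))); last first.
  rewrite size_nseq; apply: eq_bigr => r _.
  have Er : nth 0%N (nseq m d) r = d by rewrite nth_nseq ltn_ord.
  transitivity (\big[op/idx]_(c < nth 0%N (nseq m d) r)
    G (d%:Z - m%:Z - 2 * (c%:Z - r%:Z))); first by rewrite Er.
  apply: eq_bigr => c _.
  by rewrite /content flatten_indexKr ?flatten_indexKl // Er.
rewrite -big_hook size_mkseq; apply: eq_bigr => s _.
have Es : nth 0%N (hook d m) s = ((d + m).-1 - s.*2)%N by rewrite nth_mkseq.
transitivity (\big[op/idx]_(k < nth 0%N (hook d m) s)
  G ((nth 0%N (hook d m) s)%:Z - 1 - 2 * k%:Z)); last by rewrite Es.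
apply: eq_bigr => k _; rewrite /jordan_weight.
by rewrite flatten_indexKr ?flatten_indexKl ?Es.
Qed.
End Content.

(** * Transport of a Lie triple to a Jordan basis *)

Lemma char_poly_conj (F : fieldType) (n : nat) (P A : 'M[F]_n) :
  P \in unitmx -> char_poly (P *m A *m invmx P) = char_poly A.
Proof.
move=> uP; rewrite /char_poly.
have -> : char_poly_mx (P *m A *m invmx P) =
    map_mx polyC P *m char_poly_mx A *m map_mx polyC (invmx P).
  rewrite /char_poly_mx mulmxBr mulmxBl -!map_mxM; congr (_ - _).
  by rewrite scalar_mxC -mulmxA -map_mxM mulmxV // map_mx1 mulmx1.
rewrite !det_mulmx mulrC mulrA -det_mulmx -map_mxM mulVmx //.
by rewrite map_mx1 det1 mul1r.
Qed.

Lemma lie_bracket_conj (F : fieldType) (n : nat) (P A B : 'M[F]_n) :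
  P \in unitmx -> P *m lie_bracket A B *m invmx P =
  lie_bracket (P *m A *m invmx P) (P *m B *m invmx P).
Proof.
move=> uP; have conjM (C D : 'M[F]_n) :
    P *m (C *m D) *m invmx P = P *m C *m invmx P *m (P *m D *m invmx P).
  by rewrite -!mulmxA (mulKmx uP).
by rewrite /lie_bracket mulmxBr mulmxBl !conjM.
Qed.

Lemma lie_triple_char_poly (F : numFieldType) (n : nat) (la : seq nat)
    (e h f : 'M[F]_n) : uniq la -> nilp_orbit la e -> lie_triple e h f ->
  char_poly h = \prod_(i < sumn la) ('X - ((jordan_weight la i)%:~R)%:P).
Proof.
move=> ula [sz]; case: n / sz e h f => e h f [P uP ->] [he _ ef].
have EJ : P *m (invmx P *m jordan_nilp F (sumn la) la *m P) *m invmx P =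
    jordan_nilp F (sumn la) la.
  by rewrite -!mulmxA (mulKVmx uP) mulmxV // mulmx1.
rewrite -(char_poly_conj h uP).
apply: (middle_char_poly (f := P *m f *m invmx P)) ula.
  move/(congr1 (fun A => P *m A *m invmx P)): he.
  by rewrite lie_bracket_conj // EJ -scalemxAr -scalemxAl EJ.
move/(congr1 (fun A => P *m A *m invmx P)): ef.
by rewrite lie_bracket_conj // EJ.
Qed.

(** Two factorizations of the characteristic polynomial of h into linear factors, one from its
    diagonal and one from the contents, agree up to order. *)
Lemma middle_element_content (R : realType) (n d m : nat) (h : Vsp R n) :
  (d * m)%N = n -> middle_element (hook d m) h ->
  exists s : 'S_n, forall i,
    Vval (complexV h) 0 (s i) = (d%:Z - m%:Z - 2 * content d m i)%:~R.
Proof.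
move=> hn [e [f [orb trip]]].
have chD : char_poly (diag_mx (Vval (complexV h))) =
    \prod_(i < n) ('X - (Vval (complexV h) 0 i)%:P).
  rewrite char_poly_trig ?diag_mx_is_trig //.
  by apply: eq_bigr => i _; rewrite mxE eqxx.
have := lie_triple_char_poly (hook_uniq d m) orb trip.
rewrite (big_hook_content d m _
  (fun z : int => 'X - (z%:~R : R[i])%:P : {poly R[i]})).
have -> : sumn (nseq m d) = n by rewrite sumn_nseq.
rewrite chD => chC.
have : perm_eq [tuple (d%:Z - m%:Z - 2 * content d m i)%:~R : R[i] | i < n]
               [tuple Vval (complexV h) 0 i | i < n].
  apply: prod_XsubC_eq; rewrite !big_tuple.
  under eq_bigr do rewrite tnth_mktuple.
  by under [RHS]eq_bigr do rewrite tnth_mktuple.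
case/tuple_permP=> s Es; exists s => i.
have := congr1 (nth 0 ^~ i) Es.
by rewrite !nth_mktuple tnth_mktuple => <-.
Qed.

(** * Garnir relations for the Young symmetrizer *)

Lemma sum_ord_ltn (k l : nat) : (k <= l)%N -> (\sum_(c < l | c < k) 1 = k)%N.
Proof.
by move=> le_kl; rewrite -(big_ord_widen l (fun=> 1%N)) // sum1_card card_ord.
Qed.

Section Symmetrizer.
Context (F : numFieldType) (n d m : nat) (hn : (d * m)%N = n).
Local Notation sh := (nseq m d).
Local Notation row := (reshape_index sh).
Local Notation col := (reshape_offset sh).
Local Notation c := (young_symmetrizer F n sh).
Implicit Types (i j x y : 'I_n) (g : 'S_n).

Lemma sumn_rect : sumn sh = n.
Proof. by rewrite sumn_nseq. Qed.

Lemma row_lt i : (row i < m)%N.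
Proof. by rewrite -[X in (_ < X)%N](size_nseq m d) reshape_indexP // sumn_rect. Qed.

Lemma col_lt i : (col i < d)%N.
Proof.
have := @reshape_offsetP sh i; rewrite sumn_rect => /(_ (ltn_ord i)).
by rewrite nth_nseq row_lt.
Qed.

Lemma sum_row (G : nat -> nat) (r : 'I_m) :
  (\sum_(i < n | row i == r) G i = \sum_(k < d) G (flatten_index sh r k))%N.
Proof.
have := big_reshape addn sh (fun k => if row k == r then G k else 0%N).
rewrite sumn_rect size_nseq [in X in _ -> X]big_mkcond /= => ->.
have E (s : 'I_m) : nth 0%N sh s = d by rewrite nth_nseq ltn_ord.
rewrite (bigD1 r) //= [X in (_ + X)%N]big1 ?addn0 => [|s].
  transitivity (\sum_(k < nth 0 sh r) G (flatten_index sh r k))%N.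
    by apply: eq_bigr => k _; rewrite flatten_indexKl // eqxx.
  by rewrite E.
rewrite -val_eqE => /negPf /= sr; apply: big1 => k _.
by rewrite flatten_indexKl // sr.
Qed.

Lemma card_row (r : 'I_m) : #|[set i : 'I_n | row i == r]| = d.
Proof.
rewrite -sum1_card; under eq_bigl do rewrite inE.
by rewrite (sum_row (fun=> 1%N)) sum1_card card_ord.
Qed.

Lemma card_row_before i : (\sum_(j < n | (row j == row i) && (j < i)) 1 = col i)%N.
Proof.
rewrite big_mkcondr.
rewrite (sum_row (fun k => if (k < i)%N then 1%N else 0%N) (Ordinal (row_lt i))).
rewrite -big_mkcond /= -[RHS](sum_ord_ltn (ltnW (col_lt i))).
apply: eq_bigl => k; rewrite -[X in (_ < X)%N](reshape_indexK sh i).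
by rewrite /flatten_index ltn_add2l.
Qed.

Lemma tperm_row_stab x y : row x = row y -> tperm x y \in row_stab n sh.
Proof.
by move=> hxy; rewrite inE; apply/forallP => k; case: tpermP => [->|->|] //;
  rewrite hxy.
Qed.

Lemma tperm_col_stab x y : col x = col y -> tperm x y \in col_stab n sh.
Proof.
by move=> hxy; rewrite inE; apply/forallP => k; case: tpermP => [->|->|] //;
  rewrite hxy.
Qed.

Lemma row_stabM (p q : 'S_n) : p \in row_stab n sh ->
  ((p * q)%g \in row_stab n sh) = (q \in row_stab n sh).
Proof.
rewrite !inE => /forallP hp; apply/forallP/forallP => hq k.
  by rewrite -[k](permKV p) -permM (eqP (hq _)) eq_sym hp.
by rewrite permM (eqP (hq _)).
Qed.

Lemma col_stabM (p q : 'S_n) : q \in col_stab n sh ->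
  ((p * q)%g \in col_stab n sh) = (p \in col_stab n sh).
Proof.
rewrite !inE => /forallP hq; apply/forallP/forallP => hp k.
  by rewrite -(eqP (hq (p k))) -permM.
by rewrite permM (eqP (hq _)).
Qed.

Lemma symmetrizer_row p g : p \in row_stab n sh -> c (p * g)%g = c g.
Proof.
move=> hp; rewrite !ffunE (reindex_inj (mulgI p)) /=.
apply: eq_big => [q|q _]; first exact: row_stabM.
by apply: eq_bigr => q' _; rewrite !ffunE -mulgA (inj_eq (mulgI p)).
Qed.

Lemma symmetrizer_col x y g : x != y -> col x = col y ->
  c (g * tperm x y)%g = - c g.
Proof.
move=> xy hc; rewrite !ffunE -sumrN; apply: eq_bigr => p _.
rewrite (reindex_inj (mulIg (tperm x y))) /= -sumrN.
apply: eq_big => [q|q _]; first exact/col_stabM/tperm_col_stab.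
by rewrite !ffunE mulgA (inj_eq (mulIg _)) odd_permM odd_tperm xy
  signr_addb mulrN1 mulNr.
Qed.

(** A permutation preserving the row and the column of every box is trivial, so only p = q = 1
    contributes. This shows that the symmetrizer is nonzero. *)
Lemma symmetrizer1 : c 1%g = 1.
Proof.
have one_row : 1%g \in row_stab n sh.
  by rewrite inE; apply/forallP => k; rewrite perm1.
have one_col : 1%g \in col_stab n sh.
  by rewrite inE; apply/forallP => k; rewrite perm1.
rewrite ffunE (bigD1 1%g) //= (bigD1 1%g) //= ffunE mulg1 eqxx odd_perm1 mulr1.
rewrite [X in _ + X + _]big1 ?addr0 => [|q /andP[_ q1]]; last first.
  by rewrite ffunE mul1g eq_sym (negPf q1) mulr0.
rewrite big1 ?addr0 // => p /andP[hp p1]; apply: big1 => q hq.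
rewrite ffunE; case: eqP => [pq|_]; last by rewrite mulr0.
case/eqP: p1; apply/permP => k; rewrite perm1; apply/val_inj.
have Eq : q = p^-1%g by apply/eqP; rewrite eq_sym eq_invg_mul pq.
move: hp hq; rewrite Eq !inE => /forallP/(_ k)/eqP hr /forallP/(_ (p k))/eqP.
rewrite permK => hc.
by rewrite /= -(reshape_indexK sh k) -(reshape_indexK sh (p k)) hr hc.
Qed.

(* The sum is invariant under the transpositions of d + 1 points, two of which
   g sends to the same column. *)
Lemma garnir i (r : 'I_m) g : row i != r ->
  c g + \sum_(j : 'I_n | row j == r) c (tperm i j * g)%g = 0.
Proof.
move=> ir; pose G g := c g + \sum_(j : 'I_n | row j == r) c (tperm i j * g)%g.
rewrite -/(G g).
(* Translation by (i y) exchanges the leading term with the term j = y; every other term gains a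
   transposition (y j) inside row r, which the symmetrizer absorbs. *)
have G_i y g' : row y = r -> G (tperm i y * g')%g = G g'.
  move=> hy; rewrite /G (bigD1 y) ?hy //= mulgA tperm2 mul1g.
  rewrite [in RHS](bigD1 y) ?hy //= [LHS]addrCA.
  congr (_ + (_ + _)); apply: eq_bigr => j /andP[/eqP hj jy].
  have ij : i != j by apply: contraNneq ir => ->; rewrite hj.
  have iy : i != y by apply: contraNneq ir => ->; rewrite hy.
  have -> : (tperm i j * (tperm i y * g') = tperm y j * (tperm i j * g'))%g.
    rewrite !mulgA; congr (_ * _)%g.
    rewrite [LHS]conjgC tpermJ tpermL tpermD // 1?eq_sym //.
    by rewrite [LHS]conjgC tpermJ tpermL [tperm y j i]tpermD // eq_sym.
  by rewrite symmetrizer_row // tperm_row_stab // hy hj.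
have G_row x y g' : row x = r -> row y = r -> G (tperm x y * g')%g = G g'.
  move=> hx hy; have hxy := etrans hx (esym hy).
  rewrite /G symmetrizer_row ?tperm_row_stab //; congr (_ + _).
  rewrite [RHS](reindex_inj (@perm_inj _ (tperm x y))) /=.
  have rowt j : row (tperm x y j) = row j.
    by have := tperm_row_stab hxy; rewrite inE => /forallP/(_ j)/eqP.
  apply: eq_big => [j|j _]; first by rewrite rowt.
  have -> : (tperm i j * (tperm x y * g') =
             tperm x y * (tperm i (tperm x y j) * g'))%g.
    rewrite !mulgA; congr (_ * _)%g; rewrite [LHS]conjgC tpermJ.
    by rewrite [tperm x y i]tpermD //; apply: contraNneq ir => <-; rewrite ?hx ?hy.
  by rewrite symmetrizer_row // tperm_row_stab.
pose B := i |: [set j : 'I_n | row j == r].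
have GB x y g' : x \in B -> y \in B -> G (tperm x y * g')%g = G g'.
  rewrite !inE => /orP[/eqP->|/eqP hx] /orP[/eqP->|/eqP hy].
  - by rewrite tperm1 mul1g.
  - exact: G_i.
  - by rewrite tpermC; exact: G_i.
  - exact: G_row.
have : ~~ [forall x in B, forall y in B,
            (col (g x) == col (g y)) ==> (x == y)].
  apply/negP => /forall_inP inj.
  pose k x := Ordinal (col_lt (g x)).
  have : {in B &, injective k}.
    move=> x y hx hy [/eqP hxy]; apply/eqP.
    by have /forall_inP/(_ y hy)/implyP/(_ hxy) := inj x hx.
  move/card_in_imset => cB; have := max_card (mem (k @: B)).
  by rewrite cB cardsU1 card_row !inE ir card_ord add1n ltnn.
case/forall_inPn => x hx /forall_inPn[y hy]; rewrite negb_imply.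
case/andP=> /eqP hc xy.
(* Moved to the right of g, the transposition (x y) becomes a column transposition and changes the
   sign of each term; with [GB] this gives 2 G g = 0. *)
have : G (tperm x y * g)%g = - G g.
  have comm (u : 'S_n) : (u * (tperm x y * g) = u * g * tperm (g x) (g y))%g.
    by rewrite -mulgA; congr (u * _)%g; rewrite [LHS]conjgC tpermJ.
  have gxy : g x != g y by rewrite (inj_eq perm_inj).
  rewrite /G opprD -sumrN -[X in c X + _]mul1g comm mul1g symmetrizer_col //.
  by congr (_ + _); apply: eq_bigr => j _; rewrite comm symmetrizer_col.
rewrite GB // => /eqP; rewrite -addr_eq0 -mulr2n -mulr_natl mulf_eq0 pnatr_eq0.
by move/eqP.
Qed.

Lemma sum_rows (P : pred 'I_n) (f : 'I_n -> F) :
  \sum_(j | P j) f j = \sum_(r < m) \sum_(j : 'I_n | (row j == r) && P j) f j.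
Proof.
rewrite (partition_big (fun j => Ordinal (row_lt j)) xpredT) //=.
by apply: eq_bigr => r _; apply: eq_bigl => j; rewrite andbC -val_eqE.
Qed.

(** The row of i contributes d - 1 by invariance, and each of the m - 1 other rows contributes -1 by
    [garnir]. *)
Lemma symmetrizer_sum i g :
  \sum_(j | j != i) c (tperm i j * g)%g = (d%:R - m%:R) * c g.
Proof.
rewrite sum_rows (bigD1 (Ordinal (row_lt i))) //=.
transitivity ((d%:R - 1) * c g + \sum_(r < m | r != Ordinal (row_lt i)) - c g).
  congr (_ + _); last first.
    apply: eq_bigr => r; rewrite -val_eqE /= eq_sym => ir.
    apply/eqP; rewrite -addr_eq0 addrC; apply/eqP; rewrite -[RHS](garnir g ir).
    congr (_ + _); apply: eq_bigl => j; case: eqP => //= hj.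
    by apply: contraNneq ir => <-; rewrite hj.
  rewrite (eq_bigr (fun=> c g)) => [|j /andP[/eqP hj _]]; last first.
    by rewrite symmetrizer_row // tperm_row_stab.
  have := card_row (Ordinal (row_lt i)).
  rewrite (cardsD1 i) inE eqxx add1n => dE.
  rewrite -[X in _ = (X%:R - 1) * _]dE -natr1 addrK.
  rewrite sumr_const mulr_natl; congr (_ *+ _).
  by apply: eq_card => j; rewrite !inE andbC.
have := cardC1 (Ordinal (row_lt i)); rewrite card_ord => mE.
have m_gt0 := leq_ltn_trans (leq0n _) (row_lt i).
rewrite sumr_const mE -mulr_natl -[X in (_ - X%:R) * _](prednK m_gt0).
by rewrite -natr1; ring.
Qed.

(** The points before i fill the rows above it, each contributing -1 by [garnir], and the [col i]
    boxes to its left, each contributing 1. *)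
Lemma symmetrizer_content i g :
  \sum_(j < n | (j < i)%N) c (tperm i j * g)%g = (content d m i)%:~R * c g.
Proof.
have lt_ji j : (j < i)%N =
    ((row j < row i) || ((row j == row i) && (col j < col i)))%N.
  have := reshape_leq sh i j; rewrite ltnNge => ->.
  by case: ltngtP => //=; rewrite ltnNge.
rewrite sum_rows.
transitivity (\sum_(r < m) ((if (r < row i)%N then - c g else 0) +
   (if r == Ordinal (row_lt i) then (col i)%:R * c g else 0))).
  apply: eq_bigr => r _; rewrite -val_eqE /=.
  case: ltngtP => [ri|ri|ri]; rewrite ?addr0 ?add0r.
  - apply/eqP; rewrite -addr_eq0 addrC; apply/eqP.
    rewrite -[RHS](@garnir i r g) ?gtn_eqF //.
    by congr (_ + _); apply: eq_bigl => j; rewrite lt_ji;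
      case: eqP => //= ->; rewrite ri.
  - apply: big1 => j; rewrite lt_ji => /andP[/eqP ->].
    by rewrite ltnNge (ltnW ri) gtn_eqF.
  rewrite ri (eq_bigr (fun=> c g)) => [|j /andP[/eqP hj _]]; last first.
    by rewrite symmetrizer_row // tperm_row_stab // hj ri.
  by rewrite sumr_const mulr_natl -sum1_card card_row_before.
rewrite big_split /= -!big_mkcond /= big_pred1_eq sumr_const -sum1_card.
rewrite sum_ord_ltn ?(ltnW (row_lt i)) // /content rmorphB /=.
by rewrite -[_ *+ row i]mulr_natl mulrBl mulrN addrC.
Qed.

End Symmetrizer.

(** * The elements Z(u) of the Hecke algebra *)

Section SymmetricGroup.
Context (n : nat).

(** The adjacent transpositions generate: (x y) is the conjugate of (x y-1) by (y-1 y), by induction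
    on the distance y - x. *)
Lemma simple_refl_ind (P : 'S_n -> Prop) :
  P 1%g -> (forall j, P (simple_refl j)) ->
  (forall u w, P u -> P w -> P (u * w)%g) -> forall w, P w.
Proof.
move=> P1 Ps PM.
have Plt k (x y : 'I_n) : y = (x + k.+1)%N :> nat -> P (tperm x y).
  elim: k x y => [|k IH] x y Ey.
    have lt_x : (x < n.-1)%N by have := ltn_ord y; lia.
    have -> : tperm x y = simple_refl (Ordinal lt_x).
      by congr tperm; apply: val_inj => //=; rewrite Ey addn1.
    exact: Ps.
  have lt_y : (y.-1 < n.-1)%N by have := ltn_ord y; lia.
  pose s := simple_refl (Ordinal lt_y).
  pose z := curord (Ordinal lt_y).
  have Es : s = tperm z y by congr tperm; apply: val_inj => /=; lia.
  have -> : tperm x y = (s * (tperm x z * s))%g.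
    have xz : z != x by rewrite -val_eqE /=; lia.
    have xy : y != x by rewrite -val_eqE /=; lia.
    have := tpermJ x z s; rewrite /conjg {1}Es tpermV -Es => ->.
    by rewrite Es tpermL tpermD.
  by apply: (PM _ _ (Ps _)); apply: PM (Ps _); apply: IH => /=; lia.
have Pt (x y : 'I_n) : P (tperm x y).
  have [xy|yx|/val_inj->] := ltngtP x y; last by rewrite tperm1.
    by apply: (Plt (y - x.+1)%N); lia.
  by rewrite tpermC; apply: (Plt (x - y.+1)%N); lia.
move=> w; have [ts -> _] := prod_tpermP w.
elim: ts => [|t ts IH]; first by rewrite big_nil.
by rewrite big_cons; exact: PM.
Qed.

End SymmetricGroup.

Section ReducedGenerator.
Context (R : realType) (n : nat).
Implicit Types (v : Vsp R[i] n) (i j k : 'I_n).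

(** The Jucys-Murphy elements weighted by the coordinates of v; adding [hV v] gives the element
    Z(v). *)
Definition jm_part v : hecke R n :=
  \sum_(i < n) \sum_(j < n) (Vval v 0 i * (j < i)%N%:R) *: hT R (tperm i j).

Definition reduced v : hecke R n := hV v + jm_part v.

Lemma reduced_linear : linear reduced.
Proof.
move=> c u v; rewrite /reduced linearP scalerDr addrACA; congr (_ + _).
rewrite scaler_sumr -big_split; apply: eq_bigr => i _ /=.
rewrite scaler_sumr -big_split; apply: eq_bigr => j _ /=.
by rewrite !mxE scalerA -scalerDl mulrDl mulrA.
Qed.

HB.instance Definition _ := GRing.isLinear.Build R[i] (Vsp R[i] n) (hecke R n)
  _ reduced reduced_linear.

Lemma hT_tperm w i j :
  hT R w * hT R (tperm i j) = hT R (tperm (w^-1%g i) (w^-1%g j)) * hT R w.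
Proof. by rewrite -!hTM -tpermJ /conjg invgK !mulgA mulgKV. Qed.

(** Moving v past t_s leaves a scalar. Conjugating the Jucys-Murphy part by s reverses the order of
    one pair only, and this cancels the scalar. *)
Lemma reduced_simple (l : 'I_n.-1) v :
  hT R (simple_refl l) * reduced v =
  reduced (actV (simple_refl l) v) * hT R (simple_refl l).
Proof.
pose p := curord l; pose q := sucord l; set s := simple_refl l.
have pq : (q : nat) = p.+1 by [].
have sE : s = tperm p q by [].
have ss (i : 'I_n) : s (s i) = i by rewrite sE tpermK.
have sV : (s^-1 = s)%g by rewrite sE tpermV.
have ttE : hT R s * hT R s = 1 by rewrite -hTM sE tperm2 hT1.
rewrite /reduced mulrDr mulrDl.
have := hV_cross l (actV s v); rewrite -/s.
have -> : actV s (actV s v) = v by rewrite -actVM sE tperm2 actV1.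
move/eqP; rewrite subr_eq addrC => /eqP ->.
rewrite -addrA; congr (_ + _).
rewrite dotV_root !mxE -/s -/p -/q {2 3}sE tpermL tpermR.
pose X i j := Vval v 0 i *: (hT R s * hT R (tperm i j)).
(* The pairs j < i whose order s preserves: its only inversion is at (q, p). *)
pose e i j := ((j < i)%N && ~~ ((i == q) && (j == p))).
have sumX (i0 j0 : 'I_n) :
    \sum_i \sum_j ((i == i0) && (j == j0))%:R *: X i j = X i0 j0.
  rewrite (bigD1 i0) //= (bigD1 j0) //= !eqxx scale1r.
  rewrite [X in _ + X + _]big1 ?addr0 => [|j /negPf->]; last by rewrite scale0r.
  by rewrite big1 ?addr0 // => i /negPf->; apply: big1 => j; rewrite scale0r.
have splitX (b : 'I_n -> 'I_n -> bool) (i0 j0 : 'I_n) :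
    (forall i j, ((b i j : nat) = e i j + ((i == i0) && (j == j0)))%N) ->
    \sum_i \sum_j (b i j)%:R *: X i j =
    \sum_i \sum_j (e i j)%:R *: X i j + X i0 j0.
  move=> bE; rewrite -[X i0 j0]sumX -big_split; apply: eq_bigr => i _ /=.
  rewrite -big_split; apply: eq_bigr => j _ /=.
  by rewrite -scalerDl -natrD bE.
have -> : hT R s * jm_part v = \sum_(i < n) \sum_(j < n) (j < i)%N%:R *: X i j.
  rewrite mulr_sumr; apply: eq_bigr => i _; rewrite mulr_sumr.
  by apply: eq_bigr => j _; rewrite -scalerAr /X scalerA mulrC.
have -> : jm_part (actV s v) * hT R s =
    \sum_(i < n) \sum_(j < n) (s j < s i)%N%:R *: X i j.
  rewrite mulr_suml (reindex_inj (@perm_inj _ s)) /=; apply: eq_bigr => i _.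
  rewrite mulr_suml (reindex_inj (@perm_inj _ s)) /=; apply: eq_bigr => j _.
  rewrite mxE ss -scalerAl /X scalerA [in RHS]mulrC; congr (_ *: _).
  by rewrite hT_tperm sV.
rewrite (splitX (fun i j => (j < i)%N) q p); last first.
  move=> i j; rewrite /e; case: (boolP ((i == q) && (j == p))) => [|_].
    by case/andP=> /eqP-> /eqP->; rewrite pq ltnSn.
  by rewrite andbT addn0.
rewrite (splitX (fun i j => (s j < s i)%N) p q); last first.
  move=> i j; rewrite /e -!val_eqE /=; have /= := pq.
  by rewrite sE; do 2 case: tpermP => [->|->|/eqP + /eqP]; rewrite -?val_eqE /=; lia.
(* The leftover terms are v_q and v_p, as t_s t_s = 1; their difference is the scalar of the cross
   relation. *)
rewrite addrCA; congr (_ + _); rewrite /X tpermC -sE ttE.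
by rewrite scalerBl subrK.
Qed.

Lemma reduced_equivariant w v :
  hT R w * reduced v = reduced (actV w v) * hT R w.
Proof.
elim/simple_refl_ind: w v => [|l|u w IHu IHw] v.
- by rewrite hT1 actV1 mul1r mulr1.
- exact: reduced_simple.
- by rewrite hTM -mulrA IHw mulrA IHu actVM -mulrA.
Qed.

Definition tsum j : hecke R n := \sum_(k | k != j) hT R (tperm j k).

Fact weight_subproof i : delta_mx 0 i - const_mx (n%:R^-1) \in @tracefree R[i] n.
Proof.
apply/eqP; under eq_bigr do rewrite !mxE eqxx /=.
rewrite big_split sumrN /= (bigD1 i) //= eqxx big1 => [|k /negPf-> //].
rewrite sumr_const card_ord -[_ *+ n]mulr_natl mulfV ?addr0 ?subrr //.
by rewrite pnatr_eq0 -lt0n (leq_ltn_trans (leq0n _) (ltn_ord i)).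
Qed.

(** The orthogonal projection of the coordinate vector e_i to the trace-zero hyperplane. *)
Definition weight i : Vsp R[i] n := MkV (weight_subproof i).

Lemma actV_weight w i : actV w (weight i) = weight (w^-1%g i).
Proof.
apply/val_inj/rowP => k; rewrite !mxE eqxx /=; congr (_%:R - _).
by rewrite -[X in _ == X](permKV w) (inj_eq perm_inj).
Qed.

(* [tsum j, reduced (weight i)] vanishes on X, and only its term at the
   transposition (j i) is not trivially zero. *)
Lemma reduced_root_eq0 (X : lmodType (hecke R n)) (a : R[i]) :
  (forall j (x : X), tsum j *: x = a%:A *: x) ->
  forall i j (x : X), reduced (rootV _ i j) *: x = 0.
Proof.
move=> hT_a i j x; have [->|ij] := eqVneq i j.
  have -> : rootV R[i] j j = 0 by apply/val_inj/rowP => k; rewrite !mxE subrr.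
  by rewrite linear0 scale0r.
have -> : reduced (rootV R[i] i j) = reduced (weight i) - reduced (weight j).
  by rewrite -linearB; congr reduced; apply/val_inj/rowP => k; rewrite !mxE; ring.
suff E : reduced (weight i) *: x = reduced (weight j) *: x.
  by rewrite scalerBl E subrr.
(* With y = t_(j i) x, the two sides of the surviving term become Z(e_i - mean) x and Z(e_j - mean)
   x. *)
have [y yK] : exists y, hT R (tperm j i) *: y = x.
  by exists (hT R (tperm j i) *: x); rewrite scalerA -hTM tperm2 hT1 scale1r.
have comm : reduced (weight i) *: (tsum j *: y) =
            tsum j *: (reduced (weight i) *: y).
  by rewrite !hT_a !scalerA mulr_algl mulr_algr.
move/eqP: comm; rewrite !scalerA mulr_sumr mulr_suml.
rewrite (bigD1 i) //= [in X in _ == X](bigD1 i) //= !scalerDl.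
rewrite [X in _ == _ + X *: _](eq_bigr
  (fun k => reduced (weight i) * hT R (tperm j k))) => [|k /andP[kj ki]].
  rewrite (inj_eq (addIr _)) reduced_equivariant actV_weight tpermV tpermR.
  by rewrite -!scalerA yK -!scalerDl => /eqP.
by rewrite reduced_equivariant actV_weight tpermV tpermD // eq_sym.
Qed.

End ReducedGenerator.

(** * Central elements *)

(** Peeling off one variable at a time matches the cross relation, which moves a single vector past
    t_s. *)
Lemma mpoly_ring_ind (n : nat) (K : comNzRingType) (P : {mpoly K[n]} -> Prop) :
  (forall a, P a%:MP) -> (forall p q, P p -> P q -> P (p + q)) ->
  (forall j p, P p -> P ('X_j * p)) -> forall p, P p.
Proof.
move=> PC PD PX; elim/mpolyind=> [|a m p _ _ Pp]; first by rewrite -mpolyC0.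
apply: PD Pp; rewrite -mul_mpolyC mulrC mpolyXE_id.
elim: (index_enum _) => [|j r IH]; first by rewrite big_nil mul1r.
rewrite big_cons -mulrA; elim: (m j) => [|k IHk]; first by rewrite expr0 mul1r.
by rewrite exprS -mulrA; exact: PX.
Qed.

Section SymHecke.
Context (R : realType) (n : nat).
Local Notation alpha := (simple_root R[i]).
Implicit Types (f g : {mpoly R[i][n.-1]}) (v : Vsp R[i] n) (j : 'I_n.-1).

Lemma sym_heckeC a : sym_hecke a%:MP = a%:A :> hecke R n.
Proof. exact: mmapC. Qed.

Lemma sym_heckeD f g : sym_hecke (f + g) = sym_hecke f + sym_hecke g :> hecke R n.
Proof. exact: mmapD. Qed.

Lemma sym_heckeZ a f : sym_hecke (a *: f) = a *: sym_hecke f :> hecke R n.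
Proof. by rewrite /sym_hecke mmapZ /= mulr_algl. Qed.

(** The Hecke algebra is not commutative, so the new factor is carried to its place in the ordered
    product by [hVC]. *)
Lemma sym_hecke_monomial j m :
  sym_hecke 'X_[U_(j) + m] = hV (alpha j) * sym_hecke 'X_[m] :> hecke R n.
Proof.
rewrite /sym_hecke !mmapX /mmap1.
pose t k := hV (alpha k) : hecke R n.
have comm k (e : nat) : t j * t k ^+ e = t k ^+ e * t j.
  by apply: commrX; exact: hVC.
(* Generalizing to duplicate-free lists lets the new factor appear exactly when j has been met. *)
suff H r : uniq r -> \prod_(k <- r) t k ^+ (U_(j) + m)%MM k =
    t j ^+ (j \in r) * \prod_(k <- r) t k ^+ m k.
  by rewrite H ?index_enum_uniq // mem_index_enum.
elim: r => [|k r IH]; first by rewrite !big_nil mulr1.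
rewrite /= => /andP[kr /IH {}IH]; rewrite !big_cons IH mnmDE mnm1E inE.
have [Ek|jk] := eqVneq j k.
  by rewrite -Ek in kr *; rewrite (negPf kr) mul1r exprS mulrA.
rewrite add0n /= !mulrA; congr (_ * _).
by case: (j \in r); rewrite ?expr0 ?mul1r ?mulr1 // expr1 comm.
Qed.

Lemma sym_heckeXM j f :
  sym_hecke ('X_j * f) = hV (alpha j) * sym_hecke f :> hecke R n.
Proof.
elim/mpolyind: f => [|a m p _ _ IH].
  by rewrite mulr0 /sym_hecke mmap0 mulr0.
rewrite mulrDr !sym_heckeD IH mulrDr; congr (_ + _).
by rewrite -scalerAr -mpolyXD !sym_heckeZ sym_hecke_monomial scalerAr.
Qed.

Lemma sym_heckeM f g : sym_hecke (f * g) = sym_hecke f * sym_hecke g :> hecke R n.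
Proof.
elim/mpoly_ring_ind: f => [a|p q IHp IHq|j p IH].
- by rewrite mul_mpolyC sym_heckeZ sym_heckeC mulr_algl.
- by rewrite mulrDl !sym_heckeD IHp IHq mulrDl.
- by rewrite -mulrA !sym_heckeXM IH mulrA.
Qed.

Lemma sym_hecke_hV f v : sym_hecke f * hV v = hV v * sym_hecke f :> hecke R n.
Proof. by rewrite -sym_hecke_symV -!sym_heckeM mulrC. Qed.

Lemma symV_linear : linear (@symV R n).
Proof.
move=> a u v; rewrite /symV scaler_sumr -big_split; apply: eq_bigr => j _ /=.
rewrite scalerA -scalerDl mulr_sumr -big_split; congr (_ *: _).
by apply: eq_bigr => i _; rewrite !mxE.
Qed.

HB.instance Definition _ := GRing.isLinear.Build R[i] (Vsp R[i] n)
  {mpoly R[i][n.-1]} _ (@symV R n) symV_linear.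

Lemma symV_simple_root j : symV (alpha j) = 'X_j :> {mpoly R[i][n.-1]}.
Proof.
have E (k : 'I_n.-1) (l : 'I_n) :
    \sum_(i < n | (i <= k)%N) (i == l)%:R = (l <= k)%N%:R :> R[i].
  case: leqP => [lk|kl].
    by rewrite (bigD1 l) //= eqxx big1 ?addr0 // => i /andP[_ /negPf->].
  rewrite big1 // => i ik; case: eqP => // il.
  by move: ik; rewrite il leqNgt kl.
rewrite /symV (bigD1 j) //= [X in _ + X]big1 ?addr0 => [|k kj].
  under eq_bigr do rewrite !mxE !eqxx /=.
  by rewrite sumrB !E /= leqnn ltnn subr0 scale1r.
under eq_bigr do rewrite !mxE !eqxx /=.
rewrite sumrB !E /= [X in X - _](_ : _ = (j < k)%N%:R) ?subrr ?scale0r //.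
by congr (nat_of_bool _)%:R; move: kj; rewrite -val_eqE /=; lia.
Qed.

Lemma sym_act_linX w j f :
  sym_act w ('X_j * f) = symV (actV w (alpha j)) * sym_act w f.
Proof.
by rewrite /sym_act [LHS]rmorphM /= comp_mpolyXU nth_mktuple.
Qed.

Lemma actV_simple_refl j v :
  actV (simple_refl j) v = v - dotV (alpha j) v *: alpha j.
Proof.
apply/val_inj/rowP => k; rewrite !mxE !eqxx dotV_root /= /simple_refl.
have pq : curord j != sucord j by rewrite -val_eqE /= neq_ltn ltnSn.
case: tpermP => [->|->|/eqP/negPf-> /eqP/negPf->].
- by rewrite eqxx (negPf pq) mulr1n mulr0n; ring.
- by rewrite eqxx [sucord j == _]eq_sym (negPf pq) mulr1n mulr0n; ring.
- by rewrite subrr mulr0 subr0.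
Qed.

(* g is the divided difference of f. *)
Lemma sym_hecke_cross l f : exists g,
  'X_l * g = f - sym_act (simple_refl l) f /\
  sym_hecke f * hT R (simple_refl l) =
    hT R (simple_refl l) * sym_hecke (sym_act (simple_refl l) f)
    + sym_hecke g.
Proof.
set s := simple_refl l.
elim/mpoly_ring_ind: f => [a|p q [g1 [E1 H1]] [g2 [E2 H2]]|j p [g [E H]]].
- exists 0; rewrite /sym_act comp_mpolyC subrr mulr0; split=> //.
  by rewrite /sym_hecke mmap0 addr0 mmapC /= mulr_algl mulr_algr.
- exists (g1 + g2); rewrite /sym_act comp_mpolyD -!/(sym_act s _); split.
    by rewrite mulrDr E1 E2 opprD addrACA.
  by rewrite !sym_heckeD mulrDl H1 H2 mulrDr addrACA.
pose a := dotV (alpha l) (alpha j).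
(* Twisted Leibniz rule: the divided difference of ['X_j] is the constant a, and that of p is g. *)
exists (a *: sym_act s p + 'X_j * g); rewrite sym_act_linX; split.
  rewrite mulrDr [X in _ + X]mulrCA E actV_simple_refl linearB linearZ /=.
  by rewrite !symV_simple_root -/a -!mul_mpolyC; ring.
rewrite sym_heckeXM -mulrA H mulrDr mulrA.
have /eqP := hV_cross l (alpha j); rewrite subr_eq => /eqP ->.
rewrite sym_heckeM sym_hecke_symV sym_heckeD sym_heckeZ sym_heckeXM -/s -/a.
by rewrite mulrDl mulr_algl [X in X + _]addrC -addrA mulrA.
Qed.

(** For invariant f the divided difference g satisfies ['X_l * g = 0], hence vanishes, and f
    commutes with each t_s. *)
Lemma sym_hecke_central f : (forall w, sym_act w f = f) ->
  forall a : hecke R n, sym_hecke f * a = a * sym_hecke f.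
Proof.
move=> inv; elim/hcls_ind; elim=> [c|w|v|a IHa b IHb|a IHa b IHb].
- by rewrite hclsZE mulr_algl mulr_algr.
- rewrite -/(hT R w); elim/simple_refl_ind: w => [|l|u w IHu IHw].
  + by rewrite hT1 mulr1 mul1r.
  + have [g []] := sym_hecke_cross l f; rewrite inv subrr => /eqP.
    rewrite mulf_eq0 => /orP[|/eqP->]; last by rewrite /sym_hecke mmap0 addr0.
    (* ['X_l] is nonzero because it takes the value 1 where all coordinates are 1. *)
    move/eqP/(congr1 (meval (fun=> 1))).
    by rewrite mevalXU meval0 => /eqP; rewrite oner_eq0.
  + by rewrite hTM mulrA IHu -mulrA IHw mulrA.
- exact: sym_hecke_hV.
- by rewrite hclsDE mulrDr IHa IHb mulrDl.
- by rewrite hclsME mulrA IHa -mulrA IHb mulrA.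
Qed.

Lemma sym_hecke_eigen (X : lmodType (hecke R n)) (x : X) (mu : 'I_n.-1 -> R[i]) :
  (forall j, hV (alpha j) *: x = (mu j)%:A *: x) ->
  forall f, sym_hecke f *: x = (f.@[mu])%:A *: x.
Proof.
move=> hx; elim/mpoly_ring_ind=> [a|p q IHp IHq|j p IH].
- by rewrite sym_heckeC mevalC.
- by rewrite sym_heckeD scalerDl IHp IHq mevalD !scalerDl.
- have comm (a : R[i]) : hV (alpha j) * a%:A = a%:A * hV (alpha j).
    by rewrite mulr_algl mulr_algr.
  rewrite sym_heckeXM -scalerA IH scalerA comm -scalerA hx.
  by rewrite scalerA mevalM mevalXU mulr_algl scalerA mulrC.
Qed.

Lemma meval_symV v (mu : Vsp R[i] n) :
  (symV v).@[fun j => dotV (alpha j) mu] = dotV v mu.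
Proof.
have vE i : Vval v 0 i = \sum_(j < n.-1)
    (\sum_(k < n | (k <= j)%N) Vval v 0 k) * Vval (alpha j) 0 i.
  rewrite [in LHS](symV_coord v) -[Vval _]/(val _) raddf_sum summxE.
  by apply: eq_bigr => j _; rewrite /= mxE.
rewrite /dotV; under [RHS]eq_bigr do rewrite vE mulr_suml.
rewrite exchange_big /symV raddf_sum; apply: eq_bigr => j _ /=.
by rewrite mevalZ mevalXU mulr_sumr; apply: eq_bigr => i _; rewrite mulrA.
Qed.

Lemma sym_eval_act w f (mu : Vsp R[i] n) :
  sym_eval (sym_act w f) mu = sym_eval f (actV w^-1%g mu).
Proof.
rewrite /sym_eval /sym_act comp_mpoly_meval; apply: meval_eq => j.
rewrite tnth_mktuple meval_symV -[in LHS](actV1 mu) -(mulgV w) actVM.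
by rewrite dotV_act.
Qed.

End SymHecke.

(** * The central character *)

Section RestrictionIso.
Context (R : realType) (n : nat) (X : lmodType (hecke R n)).
Context (phi : X -> {ffun 'S_n -> R[i]}).
Hypothesis phi_lin :
  forall c x y w, phi (c%:A *: x + y) w = c * phi x w + phi y w.
Hypothesis phi_hT :
  forall u x, phi (hT R u *: x) = gconv (gdelta R[i] u) (phi x).

Lemma phi0 : phi 0 = 0.
Proof.
apply/ffunP => w; have := phi_lin 1 0 0 w; rewrite scaler0 addr0 mul1r ffunE.
by move/eqP; rewrite -subr_eq subrr eq_sym => /eqP.
Qed.

Lemma phi_hTE u x w : phi (hT R u *: x) w = phi x (u^-1 * w)%g.
Proof.
rewrite phi_hT ffunE (bigD1 u) //= ffunE eqxx mul1r big1 ?addr0 // => k /negPf ku.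
by rewrite ffunE ku mul0r.
Qed.

Lemma phi_tperm_sum (I : finType) (P : pred I) (p q : I -> 'I_n) x w :
  phi ((\sum_(k | P k) hT R (tperm (p k) (q k))) *: x) w =
  \sum_(k | P k) phi x (tperm (p k) (q k) * w)%g.
Proof.
elim/big_rec2: _ => [|k y h _ IH]; first by rewrite scale0r phi0 ffunE.
rewrite scalerDl -[hT R _ *: x]scale1r -(scale1r (1 : hecke R n)) phi_lin mul1r.
by rewrite phi_hTE tpermV IH.
Qed.

End RestrictionIso.

(** Makes the common eigenspace of all the [tsum j] stable under S_n. *)
Lemma tsum_hT (R : realType) (n : nat) (w : 'S_n) (j : 'I_n) :
  tsum R j * hT R w = hT R w * tsum R (w j).
Proof.
rewrite /tsum mulr_suml mulr_sumr [RHS](reindex_inj (@perm_inj _ w)) /=.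
apply: eq_big => [k|k _]; first by rewrite (inj_eq perm_inj).
by rewrite hT_tperm !permK.
Qed.

Theorem mainTheorem4 (R : realType) (n d m : nat) (hd : (1 <= d)%N)
    (hm : (1 <= m)%N) (hn : (d * m)%N = n) (X : lmodType (hecke R n))
    (X1 : one_W_type X) (Xdm : restriction_iso X (nseq m d))
    (h : Vsp R n) (hh : middle_element (hook d m) h) :
  has_central_character X (complexV (2^-1 *: h)).
Proof.
case: X1 => [[_ simpleX] _ [_ irrX]].
case: Xdm => phi [phi_lin phi_hT phi_inj phi_im].
have [v phi_v] : exists v, phi v = young_symmetrizer R[i] n (nseq m d).
  apply/phi_im; exists (gdelta R[i] 1%g); apply/ffunP => w.
  rewrite [RHS]ffunE (bigD1 1%g) //= big1 ?addr0 => [|k /negPf k1].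
    by rewrite [gdelta _ _ _]ffunE eqxx mul1r invg1 mul1g.
  by rewrite [gdelta _ _ _]ffunE k1 mul0r.
have v_neq0 : v != 0.
  apply/eqP => v0; have := symmetrizer1 R[i] n d m.
  by rewrite -phi_v v0 (phi0 phi_lin) ffunE => /eqP; rewrite eq_sym oner_eq0.
have phi_scale a x w : phi (a%:A *: x) w = a * phi x w.
  by rewrite -[_ *: x]addr0 phi_lin (phi0 phi_lin) ffunE addr0.
have tsum_v j : tsum R j *: v = (d%:R - m%:R)%:A *: v.
  apply: phi_inj; apply/ffunP => w; rewrite phi_scale.
  by rewrite (phi_tperm_sum phi_lin phi_hT) phi_v symmetrizer_sum.
(* The condition is imposed for all j at once, since S_n permutes the [tsum j]; irreducibility of
   the restriction then spreads it from v to X. *)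
have tsum_X j (x : X) : tsum R j *: x = (d%:R - m%:R)%:A *: x.
  pose S : {pred X} :=
    fun x => `[< forall j, tsum R j *: x = (d%:R - m%:R)%:A *: x >].
  have SP y : y \in S <-> forall j, tsum R j *: y = (d%:R - m%:R)%:A *: y.
    by rewrite unfold_in; split=> /asboolP.
  have comm (a b : R[i]) (y : X) : a%:A *: (b%:A *: y) = b%:A *: (a%:A *: y).
    by rewrite !scalerA !mulr_algl !scalerA mulrC.
  have comm' (a : R[i]) (b : hecke R n) (y : X) :
      b *: (a%:A *: y) = a%:A *: (b *: y).
    by rewrite !scalerA mulr_algl mulr_algr.
  have [|S0|ST] := irrX S.
  - split=> [|c y z /SP hy /SP hz|w y /SP hy]; apply/SP => k.
    + by rewrite !scaler0.
    + by rewrite scalerDr comm' hy hz [RHS]scalerDr [in RHS]comm.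
    + by rewrite scalerA tsum_hT -scalerA hy !comm'.
  - have : v \in S by apply/SP.
    by rewrite S0 inE (negPf v_neq0).
  - by have /SP := ST x.
have [s hs] := middle_element_content hn hh.
(* nu rearranges h/2 so that its coordinate at box i is (d - m)/2 minus the content of i. *)
pose mu := complexV (2^-1 *: h); pose nu := actV s mu.
have nuE i : Vval nu 0 i = (d%:R - m%:R) / 2 - (content d m i)%:~R.
  rewrite !mxE rmorphM /= fmorphV rmorph_nat.
  have := hs i; rewrite mxE => ->; move: (content d m i) => z.
  by rewrite !rmorphB rmorphM /= -!pmulrn natrD; field.
have jm_v u : jm_part u *: v =
    (\sum_i Vval u 0 i * (content d m i)%:~R)%:A *: v.
  rewrite !scaler_suml; apply: eq_bigr => i _.
  transitivity ((Vval u 0 i)%:A *: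
     ((\sum_(j < n | (j < i)%N) hT R (tperm i j)) *: v)).
    rewrite scalerA mulr_algl scaler_sumr [in RHS]big_mkcond.
    congr (_ *: v); apply: eq_bigr => j _; case: ifP => _; first by rewrite mulr1.
    by rewrite mulr0 scale0r.
  have -> : (\sum_(j < n | (j < i)%N) hT R (tperm i j)) *: v =
      ((content d m i)%:~R)%:A *: v.
    apply: phi_inj; apply/ffunP => w; rewrite phi_scale.
    by rewrite (phi_tperm_sum phi_lin phi_hT) phi_v symmetrizer_content.
  by rewrite scalerA mulr_algl scalerA.
(* Z vanishes on v, so a root acts by minus its pairing with the contents; the constant (d - m)/2
   pairs to zero with a root. *)
have hV_v l : hV (simple_root R[i] l) *: v = (dotV (simple_root R[i] l) nu)%:A *: v.
  have := reduced_root_eq0 tsum_X (curord l) (sucord l) v.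
  rewrite -/(simple_root _ _) scalerDl jm_v => /eqP.
  rewrite addr_eq0 => /eqP ->; rewrite -scaleNr -scaleNr; congr (_ *: _ *: _).
  rewrite /dotV; under [RHS]eq_bigr do rewrite nuE mulrBr.
  rewrite big_split sumrN /= -mulr_suml.
  by rewrite (eqP (VvalP (simple_root R[i] l))) mul0r add0r.
move=> f inv x.
(* Invariance of f under s replaces the weight nu of v by h/2. *)
have f_v : sym_hecke f *: v = (sym_eval f mu)%:A *: v.
  rewrite (sym_hecke_eigen hV_v) -[in RHS](inv s^-1%g) sym_eval_act invgK.
  by [].
(* An eigenspace of a central element is a submodule; it contains v, so by simplicity it is X. *)
pose S : {pred X} := fun x => sym_hecke f *: x == (sym_eval f mu)%:A *: x.
have [|S0|ST] := simpleX S.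
- split=> [|a y z]; rewrite !unfold_in; first by rewrite !scaler0.
  move=> /eqP hy /eqP hz; rewrite !scalerDr hz !scalerA sym_hecke_central //.
  by rewrite -scalerA hy scalerA mulr_algl mulr_algr.
- have : v \in S by rewrite unfold_in f_v.
  by rewrite S0 inE (negPf v_neq0).
- by apply/eqP; have := ST x; rewrite unfold_in.
Qed.
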